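(* Let $(A,\ast_1,\circ_1)$ be a pre-Poisson algebra equipped with two comultiplications (linear maps) $\Delta,\delta:A\to A\otimes A$. Suppose that $\Delta^{*},\delta^{*}:A^{*}\otimes A^{*}\to A^{*}$ induce a pre-Poisson algebra structure on $A^{*}$, and put $\ast_2=\Delta^{*}$, $\circ_2=\delta^{*}$. Then the following conditions are equivalent: (1) There is a quadratic pre-Poisson algebra $(A\oplus A^{*},\ast,\circ,\omega)$ such that $(A,\ast_1,\circ_1)$ and $(A^{*},\ast_2,\circ_2)$ are pre-Poisson subalgebras, where the bilinear form $\omega$ on $A\oplus A^{*}$ is $\omega(x+a,y+b)=\langle x,b\rangle-\langle a,y\rangle$ for all $x,y\in A$, $a,b\in A^{*}$. (2) $(A,A^{*},-L_{\ast_1}^{*},L_{\circ_1}^{*},-L_{\ast_2}^{*},L_{\circ_2}^{*})$ is a matched pair of Poisson algebras (between the sub-adjacent Poisson algebras of $A$ and $A^*$). (3) $(A,A^{*},-L_{\ast_1}^{*}-R_{\ast_1}^{*},R_{\ast_1}^{*},L_{\circ_1}^{*}-R_{\circ_1}^{*},-R_{\circ_1}^{*},-L_{\ast_2}^{*}-R_{\ast_2}^{*},R_{\ast_2}^{*},L_{\circ_2}^{*}-R_{\circ_2}^{*},-R_{\circ_2}^{*})$ is a matched pair of pre-Poisson algebras. (4) $(A,\ast_1,\circ_1,\Delta,\delta)$ is a pre-Poisson bialgebra.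
   Context: All vector spaces and algebras are finite-dimensional over a field $k$. Algebras. A Zinbiel algebra is a vector space with a bilinear map $\ast$ such that $x\ast(y\ast z)=(y\ast x)\ast z+(x\ast y)\ast z$. A pre-Lie algebra: $x\circ(y\circ z)-(x\circ y)\circ z=y\circ(x\circ z)-(y\circ x)\circ z$. A pre-Poisson algebra is $(A,\ast,\circ)$ with $(A,\ast)$ Zinbiel, $(A,\circ)$ pre-Lie, $(x\circ y-y\circ x)\ast z=x\circ(y\ast z)-y\ast(x\circ z)$ and $(x\ast y+y\ast x)\circ z=x\ast(y\circ z)+y\ast(x\circ z)$. Put $x\star y=x\ast y+y\ast x$ and $[x,y]=x\circ y-y\circ x$; $(A,\star,[\ ,\ ])$ is a Poisson algebra (commutative associative $\star$, Lie bracket, $[z,x\star y]=[z,x]\star y+x\star[z,y]$), called the sub-adjacent Poisson algebra. Notation. $L_\ast(x)y=R_\ast(y)x=x\ast y$, similarly $L_\circ,R_\circ$; $L_\star=L_\ast+R_\ast$; $\mathrm{ad}(x)=L_\circ(x)-R_\circ(x)$. For a linear map $h:A\to\mathrm{End}(V)$, $h^{*}:A\to\mathrm{End}(V^{*})$ is defined by $\langle h^{*}(x)u^{*},v\rangle=-\langle u^{*},h(x)v\rangle$. $A^{**}$ is identified with $A$. $\tau(x\otimes y)=y\otimes x$, and $I$ is the identity map. The dual product is $\langle x,a\ast_2 b\rangle=\langle\Delta(x),a\otimes b\rangle$, $\langle x,a\circ_2 b\rangle=\langle\delta(x),a\otimes b\rangle$. Quadratic pre-Poisson algebra $(A,\ast,\circ,\omega)$: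 a pre-Poisson algebra with a nondegenerate antisymmetric bilinear form $\omega$ such that $\omega(x\ast y,z)=\omega(y,x\star z)$ and $\omega(x\circ y,z)=-\omega(y,[x,z])$. Matched pair of pre-Poisson algebras $(A_1,A_2,l_1,r_1,\rho_1,\mu_1,l_2,r_2,\rho_2,\mu_2)$: linear maps $l_1,r_1,\rho_1,\mu_1:A_1\to\mathrm{End}(A_2)$, $l_2,r_2,\rho_2,\mu_2:A_2\to\mathrm{End}(A_1)$ such that $A_1\oplus A_2$ is a pre-Poisson algebra under $(x,a)\ast(y,b)=(x\ast_1 y+l_2(a)y+r_2(b)x,\ a\ast_2 b+l_1(x)b+r_1(y)a)$, $(x,a)\circ(y,b)=(x\circ_1 y+\rho_2(a)y+\mu_2(b)x,\ a\circ_2 b+\rho_1(x)b+\mu_1(y)a)$. Matched pair of Poisson algebras $(P_1,P_2,\mu_1,\rho_1,\mu_2,\rho_2)$: linear maps $\mu_1,\rho_1:P_1\to\mathrm{End}(P_2)$, $\mu_2,\rho_2:P_2\to\mathrm{End}(P_1)$ such that $P_1\oplus P_2$ is a Poisson algebra under $(x,a)\star(y,b)=(x\star_1 y+\mu_2(a)y+\mu_2(b)x,\ a\star_2 b+\mu_1(x)b+\mu_1(y)a)$, $[(x,a),(y,b)]=([x,y]_1+\rho_2(a)y-\rho_2(b)x,\ [a,b]_2+\rho_1(x)b-\rho_1(y)a)$. Coalgebras. Zinbiel coalgebra $(A,\Delta)$: $(\Delta\otimes I)\Delta+(\tau\otimes I)(\Delta\otimes I)\Delta=(I\otimes\Delta)\Delta$.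 Pre-Lie coalgebra $(A,\delta)$: $(\delta\otimes I)\delta-(I\otimes\delta)\delta=(\tau\otimes I)\big((\delta\otimes I)\delta-(I\otimes\delta)\delta\big)$. Pre-Poisson coalgebra $(A,\Delta,\delta)$: both of these together with $((\delta-\tau\delta)\otimes I)\Delta=(I\otimes\Delta)\delta-(\tau\otimes I)(I\otimes\delta)\Delta$ and $((\Delta+\tau\Delta)\otimes I)\delta=(I\otimes\delta)\Delta+(\tau\otimes I)(I\otimes\delta)\Delta$. Zinbiel bialgebra $(A,\ast,\Delta)$: a Zinbiel algebra and Zinbiel coalgebra such that for all $x,y,z$ $\Delta(y\ast z)+\tau\Delta(y\ast z)=(I\otimes L_\ast(y))\Delta(z)+\tau(L_\ast(y)\otimes I)\Delta(z)+\tau(I\otimes R_\ast(z))\Delta(y)=(I\otimes R_\ast(z))\Delta(y)+(L_\ast(y)\otimes I)\Delta(z)+\tau(I\otimes L_\ast(y))\Delta(z)$, $\Delta(x\star y)=(L_\ast(x)\otimes I)\Delta(y)+(I\otimes L_\star(y))\Delta(x)$. Pre-Lie bialgebra $(A,\circ,\delta)$: a pre-Lie algebra and pre-Lie coalgebra such that $\delta(x\circ y-y\circ x)=(L_\circ(x)\otimes I)\delta(y)+(I\otimes\mathrm{ad}(x))\delta(y)-(L_\circ(y)\otimes I)\delta(x)-(I\otimes\mathrm{ad}(y))\delta(x)$, $(I-\tau)\delta(x\circ y)=(I-\tau)\big((I\otimes R_\circ(y))\delta(x)+(L_\circ(x)\otimes I)\delta(y)+(I\otimes L_\circ(x))\delta(y)\big)$.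 Pre-Poisson bialgebra $(A,\ast,\circ,\Delta,\delta)$: $(A,\ast,\circ)$ pre-Poisson algebra, $(A,\Delta,\delta)$ pre-Poisson coalgebra, $(A,\ast,\Delta)$ Zinbiel bialgebra, $(A,\circ,\delta)$ pre-Lie bialgebra, and for all $x,y\in A$ $\delta(x\star y)=(I\otimes L_\star(x))\delta(y)+(I\otimes L_\star(y))\delta(x)-(L_\circ(x)\otimes I)\Delta(y)-(L_\circ(y)\otimes I)\Delta(x)$, $\Delta([x,y])=(L_\circ(x)\otimes I)\Delta(y)-(I\otimes L_\star(y))\delta(x)+(L_\ast(y)\otimes I)\delta(x)+(I\otimes\mathrm{ad}(x))\Delta(y)$, $\delta(x\ast y)-\tau\delta(x\ast y)=(I\otimes L_\ast(x))\delta(y)-\tau(L_\ast(x)\otimes I)\delta(y)-(L_\circ(x)\otimes I)\Delta(y)-\tau(I\otimes L_\circ(x))\Delta(y)+(I\otimes R_\ast(y))\delta(x)+\tau(I\otimes R_\circ(y))\Delta(x)$, $\Delta(x\circ y)+\tau\Delta(x\circ y)=(L_\circ(x)\otimes I)\Delta(y)+\tau(L_\circ(x)\otimes I)\Delta(y)+(I\otimes L_\circ(x))\Delta(y)+\tau(I\otimes L_\circ(x))\Delta(y)-(I\otimes R_\ast(y))\delta(x)-\tau(I\otimes R_\ast(y))\delta(x)$. *)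

(* Defs.v *)
From HB Require Import structures.
From mathcomp Require Import all_boot all_order all_algebra.

Set Implicit Arguments.
Unset Strict Implicit.
Unset Printing Implicit Defensive.

Import GRing.Theory.
Local Open Scope ring_scope.

Notation dual k A := 'Hom(A, k^o).

(* A bilinear map U x V -> W is an element of 'Hom(U, 'Hom(V, W)). In particular
   a product m on A has type 'Hom(A, 'End(A)): then m itself is the left
   multiplication L_m, and [flip m] below is the right multiplication R_m. *)

Section Bilinear.
Variable k : fieldType.
Implicit Types U V W : vectType k.

Definition bilinear_map U V W (f : U -> V -> W) : Prop :=
  (forall u, linear (f u)) /\ (forall v, linear (f ^~ v)).

Definition linfun_of U V (f : U -> V) (lf : linear f) : {linear U -> V} :=
  HB.pack f (GRing.isLinear.Build k U V *:%R f lf).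

Lemma linfunP U V (f : U -> V) : linear f -> linfun f =1 f.
Proof. by move=> lf u; rewrite -[f]/(linfun_of lf : U -> V) lfunE. Qed.

(* Only meaningful for a bilinear f, see linfun2E. *)
Definition linfun2 U V W (f : U -> V -> W) : 'Hom(U, 'Hom(V, W)) :=
  linfun (fun u => linfun (f u)).

Lemma linfun2E U V W (f : U -> V -> W) : bilinear_map f ->
  forall u v, linfun2 f u v = f u v.
Proof.
case=> l1 l2 u v; rewrite /linfun2 linfunP ?linfunP // => c u1 u2.
by apply/lfunP=> w; rewrite add_lfunE scale_lfunE !linfunP // l2.
Qed.

Lemma hom_bilinear U V W (f : 'Hom(U, 'Hom(V, W))) :
  bilinear_map (fun u v => f u v).
Proof.
split=> [u|v] c x y; first exact: linearP.
by rewrite linearP add_lfunE scale_lfunE.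
Qed.

Definition flip U V W (f : 'Hom(U, 'Hom(V, W))) : 'Hom(V, 'Hom(U, W)) :=
  linfun2 (fun v u => f u v).

Lemma flipE U V W (f : 'Hom(U, 'Hom(V, W))) u v : flip f v u = f u v.
Proof.
by rewrite linfun2E //; have [l1 l2] := hom_bilinear f; split.
Qed.

End Bilinear.

Section Duality.
Variable k : fieldType.
Implicit Types U V : vectType k.

(* h^*, characterized by <h^*(x) u, v> = - <u, h(x) v> *)
Definition dual_act U V (h : 'Hom(U, 'End(V))) : 'Hom(U, 'End(dual k V)) :=
  linfun2 (fun x (u : dual k V) => - (u \o h x)%VF).

Lemma dual_actE U V (h : 'Hom(U, 'End(V))) x (u : dual k V) v :
  dual_act h x u v = - u (h x v).
Proof.
rewrite linfun2E ?opp_lfunE ?comp_lfunE //.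
split=> [y|w] c a b; apply/lfunP=> z.
  by rewrite !(opp_lfunE, add_lfunE, scale_lfunE, comp_lfunE) scalerN opprD.
by rewrite !(opp_lfunE, add_lfunE, scale_lfunE, comp_lfunE) linearP
     add_lfunE scale_lfunE linearP scalerN opprD.
Qed.

(* The canonical isomorphism V -> V^{**}. *)
Definition bidual V : 'Hom(V, dual k (dual k V)) :=
  linfun2 (fun v (u : dual k V) => u v : k^o).

Lemma bidualE V v (u : dual k V) : bidual V v u = u v.
Proof.
rewrite linfun2E //; split=> [y|w] c a b; last exact: linearP.
by rewrite add_lfunE scale_lfunE.
Qed.

Lemma dual_separates V (v : V) : (forall u : dual k V, u v = 0) -> v = 0.
Proof.
move=> v0; rewrite (coord_vbasis (memvf v)) big1 // => i _.
have lc : linear (coord (vbasis {:V}) i : V -> k^o) by move=> c x y; rewrite linearD linearZ.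
pose e : dual k V := linfun (coord (vbasis {:V}) i : V -> k^o).
by have := v0 e; rewrite /e linfunP // => ->; rewrite scale0r.
Qed.

Lemma lker_bidual V : lker (bidual V) == 0%VS.
Proof.
apply/lker0P=> x y /lfunP exy; apply/eqP; rewrite -subr_eq0; apply/eqP.
have euv (u : dual k V) : u x = u y by rewrite -(bidualE x) exy bidualE.
apply: dual_separates => u; rewrite linearB; apply/eqP; rewrite subr_eq0; apply/eqP; exact: euv.
Qed.

Lemma dim_dual V : dim (dual k V) = dim V.
Proof. by rewrite /dim /= muln1. Qed.

Lemma bidualVK V : cancel (bidual V)^-1%VF (bidual V).
Proof.
move=> f; apply: limg_lfunVK.
suff -> : limg (bidual V) = fullv by rewrite memvf.
apply/eqP; rewrite eqEdim subvf /= limg_dim_eq; last first.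
  by rewrite (eqP (lker_bidual V)) capv0.
by rewrite !dimvf !dim_dual.
Qed.

(* For h : U -> End(dual V), the map h^* : U -> End(V^{**}) transported to
   End(V) along the identification of V^{**} with V. *)
Definition predual_act U V (h : 'Hom(U, 'End(dual k V))) : 'Hom(U, 'End(V)) :=
  linfun2 (fun x v => (bidual V)^-1%VF (dual_act h x (bidual V v))).

Lemma predual_actE U V (h : 'Hom(U, 'End(dual k V))) x v (u : dual k V) :
  u (predual_act h x v) = - h x u v.
Proof.
rewrite linfun2E; last first.
  split=> [y|w] c a b; first by rewrite !linearP.
  by rewrite linearP /= add_lfunE scale_lfunE linearP.
by rewrite -bidualE bidualVK dual_actE bidualE.
Qed.

End Duality.

Section Tensor.
Variable k : fieldType.
Implicit Types A U V W : vectType k.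

(* U (x) V in coordinates; tliftE and tensor_ext show that it has the universal
   property of the tensor product. *)
Definition tensor U V : vectType k := 'M[k]_(\dim {:U}, \dim {:V}).

Definition crd U (u : U) (i : 'I_(\dim {:U})) : k := coord (vbasis {:U}) i u.
Definition vbase U (i : 'I_(\dim {:U})) : U := (vbasis {:U})`_i.

Definition tens U V (u : U) (v : V) : tensor U V :=
  \matrix_(i, j) (crd u i * crd v j).

Lemma crdP U c (u v : U) i : crd (c *: u + v) i = c * crd u i + crd v i.
Proof. by rewrite /crd linearD linearZ. Qed.

Lemma crd_sum U (u : U) : u = \sum_i crd u i *: vbase i.
Proof. exact: coord_vbasis (memvf u). Qed.

Lemma crd_vbase U i j : crd (vbase i : U) j = (i == j)%:R.
Proof.
have fX : free (vbasis {:U}) := basis_free (vbasisP _).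
by rewrite /crd /vbase coord_free // eq_sym.
Qed.

Lemma tens_bilinear U V : bilinear_map (@tens U V).
Proof.
split=> [u|v] c x y; apply/matrixP=> i j; rewrite !mxE crdP.
  by rewrite mulrDr mulrCA.
by rewrite mulrDl mulrA.
Qed.

Lemma tensor_sum U V (t : tensor U V) :
  t = \sum_i \sum_j (t : 'M[k]_(_, _)) i j *: tens (vbase i) (vbase j).
Proof.
rewrite [LHS](matrix_sum_delta (t : 'M[k]_(_, _))).
apply: eq_bigr => i _; apply: eq_bigr => j _; congr (_ *: _).
by apply/matrixP=> p q; rewrite !mxE !crd_vbase -natrM mulnb ![_ == i]eq_sym ![_ == j]eq_sym.
Qed.

(* The linear map on U (x) V induced by a bilinear map. *)
Definition tlift U V W (f : 'Hom(U, 'Hom(V, W))) : 'Hom(tensor U V, W) :=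
  linfun (fun t : tensor U V => \sum_i \sum_j
    (t : 'M[k]_(\dim {:U}, \dim {:V})) i j *: f (vbase i) (vbase j)).

Lemma tliftE U V W (f : 'Hom(U, 'Hom(V, W))) u v : tlift f (tens u v) = f u v.
Proof.
rewrite linfunP => [|c t s].
  rewrite {2}(crd_sum u) linear_sum sum_lfunE; apply: eq_bigr => i _ /=.
  rewrite linearZ scale_lfunE [in RHS](crd_sum v) linear_sum scaler_sumr /=.
  by apply: eq_bigr => j _; rewrite linearZ scalerA mxE.
rewrite scaler_sumr -big_split; apply: eq_bigr => i _ /=.
rewrite scaler_sumr -big_split; apply: eq_bigr => j _ /=.
by rewrite !mxE scalerDl scalerA.
Qed.

Lemma tensor_ext U V W (f g : 'Hom(tensor U V, W)) :
  (forall u v, f (tens u v) = g (tens u v)) -> f = g.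
Proof.
move=> fg; apply/lfunP=> t; rewrite (tensor_sum t) !linear_sum.
apply: eq_bigr => i _; rewrite !linear_sum; apply: eq_bigr => j _ /=.
by rewrite !linearZ /= fg.
Qed.

(* f (x) g *)
Definition tmap U V U' V' (f : 'Hom(U, U')) (g : 'Hom(V, V')) :
    'Hom(tensor U V, tensor U' V') :=
  tlift (linfun2 (fun u v => tens (f u) (g v))).

Lemma tmapE U V U' V' (f : 'Hom(U, U')) (g : 'Hom(V, V')) u v :
  tmap f g (tens u v) = tens (f u) (g v).
Proof.
have [l1 l2] := tens_bilinear U' V'.
rewrite tliftE linfun2E //; split=> [x|x] c y z; rewrite linearP; first exact: l1.
exact: (l2 (g x)).
Qed.

Definition tau U V : 'Hom(tensor U V, tensor V U) :=
  tlift (linfun2 (fun u v => tens v u)).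

Lemma tauE U V u v : tau U V (tens u v) = tens v u.
Proof.
by have [l1 l2] := tens_bilinear V U; rewrite tliftE linfun2E //; split.
Qed.

(* u (x) (v (x) w) |-> (u (x) v) (x) w *)
Definition tassoc U V W : 'Hom(tensor U (tensor V W), tensor (tensor U V) W) :=
  tlift (linfun2 (fun u => tlift (linfun2 (fun v w => tens (tens u v) w)))).

Lemma tassocE U V W u v w :
  tassoc U V W (tens u (tens v w)) = tens (tens u v) w.
Proof.
have [l1 l2] := tens_bilinear (tensor U V) W.
have [m1 m2] := tens_bilinear U V.
have b u' : bilinear_map (fun v' w' => tens (tens u' v') w' : tensor (tensor U V) W).
  split=> x c y z; first exact: l1.
  by rewrite m1; exact: l2.
rewrite tliftE linfun2E ?tliftE ?linfun2E //; split=> [x|t] c y z.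
  exact: linearP.
rewrite -scale_lfunE -add_lfunE; congr (fun_of_lfun _ t).
apply: tensor_ext => v' w'.
by rewrite add_lfunE scale_lfunE !tliftE !linfun2E // (m2 v') (l2 w').
Qed.

(* a (x) b as a linear form on U (x) V *)
Definition tform U V (a : dual k U) (b : dual k V) : dual k (tensor U V) :=
  tlift (linfun2 (fun u v => a u * b v : k^o)).

Lemma tformE U V (a : dual k U) (b : dual k V) u v :
  tform a b (tens u v) = a u * b v.
Proof.
rewrite tliftE linfun2E //; split=> x c y z; rewrite linearP /=.
  by rewrite mulrDr -[c *: b y]/(c * b y) mulrCA.
by rewrite mulrDl -[c *: a y]/(c * a y) -mulrA.
Qed.

(* D^* : A^* (x) A^* -> A^*, i.e. <x, a * b> = <D x, a (x) b> *)
Definition dual_prod A (D : 'Hom(A, tensor A A)) :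
    'Hom(dual k A, 'End(dual k A)) :=
  linfun2 (fun a b : dual k A => (tform a b \o D)%VF).

Lemma dual_prodE A (D : 'Hom(A, tensor A A)) (a b : dual k A) x :
  dual_prod D a b x = tform a b (D x).
Proof.
rewrite linfun2E ?comp_lfunE //; split=> [u|v] c y z; apply/lfunP=> w;
  rewrite add_lfunE scale_lfunE !comp_lfunE -scale_lfunE -add_lfunE;
  congr (fun_of_lfun _ _); apply: tensor_ext => p q;
  rewrite add_lfunE scale_lfunE !tformE add_lfunE scale_lfunE.
  by rewrite mulrDr -[c *: y q]/(c * y q) mulrCA.
by rewrite mulrDl -[c *: y p]/(c * y p) -mulrA.
Qed.

End Tensor.

Section Algebras.
Variables (k : fieldType) (A : vectType k).
Implicit Types ast circ mul br : 'Hom(A, 'End(A)).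

Definition zinbiel ast : Prop :=
  forall x y z, ast x (ast y z) = ast (ast y x) z + ast (ast x y) z.

Definition pre_lie circ : Prop :=
  forall x y z,
    circ x (circ y z) - circ (circ x y) z = circ y (circ x z) - circ (circ y x) z.

Definition sub_star ast := ast + flip ast.
Definition sub_bracket circ := circ - flip circ.

Definition pre_poisson ast circ : Prop :=
  [/\ zinbiel ast, pre_lie circ,
      forall x y z, ast (circ x y - circ y x) z
                    = circ x (ast y z) - ast y (circ x z)
    & forall x y z, circ (ast x y + ast y x) z
                    = ast x (circ y z) + ast y (circ x z)].

Definition comm_assoc mul : Prop :=
  (forall x y, mul x y = mul y x) /\
  (forall x y z, mul x (mul y z) = mul (mul x y) z).

Definition lie_bracket br : Prop :=
  (forall x, br x x = 0) /\
  (forall x y z, br x (br y z) + br y (br z x) + br z (br x y) = 0).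

Definition poisson mul br : Prop :=
  [/\ comm_assoc mul, lie_bracket br
    & forall x y z, br z (mul x y) = mul (br z x) y + mul x (br z y)].

Definition quadratic_pre_poisson ast circ (omega : 'Hom(A, dual k A)) : Prop :=
  [/\ pre_poisson ast circ,
      forall x, (forall y, omega x y = 0) -> x = 0,
      forall x y, omega x y = - omega y x,
      forall x y z, omega (ast x y) z = omega y (sub_star ast x z)
    & forall x y z, omega (circ x y) z = - omega y (sub_bracket circ x z)].

End Algebras.

Section MatchedPairs.
Variables (k : fieldType) (A1 A2 : vectType k).
Local Notation V := (A1 * A2)%type.

(* The product
   (x,a)(y,b) = (xy + l2(a)y + r2(b)x, ab + l1(x)b + r1(y)a) on A1 (+) A2. *)
Definition sum_prod (m1 : 'Hom(A1, 'End(A1))) (m2 : 'Hom(A2, 'End(A2)))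
    (l1 r1 : 'Hom(A1, 'End(A2))) (l2 r2 : 'Hom(A2, 'End(A1))) :
    'Hom(V, 'End(V)) :=
  linfun2 (fun p q : V =>
    (m1 p.1 q.1 + l2 p.2 q.1 + r2 q.2 p.1,
     m2 p.2 q.2 + l1 p.1 q.2 + r1 q.1 p.2)).

Lemma sum_prodE m1 m2 l1 r1 l2 r2 (p q : V) :
  sum_prod m1 m2 l1 r1 l2 r2 p q =
    (m1 p.1 q.1 + l2 p.2 q.1 + r2 q.2 p.1,
     m2 p.2 q.2 + l1 p.1 q.2 + r1 q.1 p.2).
Proof.
have E (W : lmodType k) (c : k) (a a' b b' e e' : W) :
    (c *: a + a') + (c *: b + b') + (c *: e + e')
    = c *: (a + b + e) + (a' + b' + e').
  by rewrite !scalerDr (addrACA (c *: a)) (addrACA (c *: a + c *: b)).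
rewrite linfun2E //; split=> u c v w; apply: injective_projections => /=;
  by rewrite -E; congr (_ + _ + _); rewrite linearP ?add_lfunE ?scale_lfunE.
Qed.

Definition matched_pre_poisson
    (ast1 circ1 : 'Hom(A1, 'End(A1))) (ast2 circ2 : 'Hom(A2, 'End(A2)))
    (l1 r1 rho1 mu1 : 'Hom(A1, 'End(A2))) (l2 r2 rho2 mu2 : 'Hom(A2, 'End(A1))) :
    Prop :=
  [/\ pre_poisson ast1 circ1, pre_poisson ast2 circ2
    & pre_poisson (sum_prod ast1 ast2 l1 r1 l2 r2)
                  (sum_prod circ1 circ2 rho1 mu1 rho2 mu2)].

Definition matched_poisson
    (mul1 br1 : 'Hom(A1, 'End(A1))) (mul2 br2 : 'Hom(A2, 'End(A2)))
    (mu1 rho1 : 'Hom(A1, 'End(A2))) (mu2 rho2 : 'Hom(A2, 'End(A1))) : Prop :=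
  [/\ poisson mul1 br1, poisson mul2 br2
    & poisson (sum_prod mul1 mul2 mu1 mu1 mu2 mu2)
              (sum_prod br1 br2 rho1 (- rho1) rho2 (- rho2))].

End MatchedPairs.

Section Bialgebras.
Variables (k : fieldType) (A : vectType k).
Implicit Types (ast circ : 'Hom(A, 'End(A))) (D d : 'Hom(A, tensor A A)).

Local Notation I := (\1%VF : 'End(A)).
Local Notation "f \ox g" := (tmap f g) (at level 35, g at next level).
Local Notation T := (tau A A).
(* A (x) A (x) A is taken to be (A (x) A) (x) A; I3 h is I \ox h followed by
   the associativity isomorphism. *)
Local Notation I3 h := (tassoc A A A \o (I \ox h))%VF.
Local Notation T12 := (T \ox I).

Definition zinbiel_coalgebra D : Prop :=
  (((D \ox I) \o D) + (T12 \o ((D \ox I) \o D)) = I3 D \o D)%VF.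

Definition pre_lie_coalgebra d : Prop :=
  (((d \ox I) \o d) - (I3 d \o d)
   = T12 \o (((d \ox I) \o d) - (I3 d \o d)))%VF.

Definition pre_poisson_coalgebra D d : Prop :=
  [/\ zinbiel_coalgebra D, pre_lie_coalgebra d,
      (((d - (T \o d)) \ox I) \o D
       = (I3 D \o d) - (T12 \o (I3 d \o D)))%VF
    & (((D + (T \o D)) \ox I) \o d
       = (I3 d \o D) + (T12 \o (I3 d \o D)))%VF].

Local Notation Lstar ast := (sub_star ast).
Local Notation ad circ := (sub_bracket circ).
Local Notation R m := (flip m).

Definition zinbiel_bialgebra ast D : Prop :=
  [/\ zinbiel ast, zinbiel_coalgebra D,
      forall y z, D (ast y z) + T (D (ast y z))
        = (I \ox ast y) (D z) + T ((ast y \ox I) (D z)) + T ((I \ox R ast z) (D y)),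
      forall y z, D (ast y z) + T (D (ast y z))
        = (I \ox R ast z) (D y) + (ast y \ox I) (D z) + T ((I \ox ast y) (D z))
    & forall x y, D (Lstar ast x y)
        = (ast x \ox I) (D y) + (I \ox Lstar ast y) (D x)].

Definition pre_lie_bialgebra circ d : Prop :=
  [/\ pre_lie circ, pre_lie_coalgebra d,
      forall x y, d (circ x y - circ y x)
        = (circ x \ox I) (d y) + (I \ox ad circ x) (d y)
          - (circ y \ox I) (d x) - (I \ox ad circ y) (d x)
    & forall x y, (\1 - T)%VF (d (circ x y))
        = (\1 - T)%VF ((I \ox R circ y) (d x) + (circ x \ox I) (d y)
                      + (I \ox circ x) (d y))].

Definition pre_poisson_compat ast circ D d : Prop :=
  [/\ forall x y, d (Lstar ast x y)
        = (I \ox Lstar ast x) (d y) + (I \ox Lstar ast y) (d x)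
          - (circ x \ox I) (D y) - (circ y \ox I) (D x),
      forall x y, D (sub_bracket circ x y)
        = (circ x \ox I) (D y) - (I \ox Lstar ast y) (d x)
          + (ast y \ox I) (d x) + (I \ox ad circ x) (D y),
      forall x y, d (ast x y) - T (d (ast x y))
        = (I \ox ast x) (d y) - T ((ast x \ox I) (d y))
          - (circ x \ox I) (D y) - T ((I \ox circ x) (D y))
          + (I \ox R ast y) (d x) + T ((I \ox R circ y) (D x))
    & forall x y, D (circ x y) + T (D (circ x y))
        = (circ x \ox I) (D y) + T ((circ x \ox I) (D y))
          + (I \ox circ x) (D y) + T ((I \ox circ x) (D y))
          - (I \ox R ast y) (d x) - T ((I \ox R ast y) (d x))].

Definition pre_poisson_bialgebra ast circ D d : Prop :=
  [/\ pre_poisson ast circ, pre_poisson_coalgebra D d,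
      zinbiel_bialgebra ast D, pre_lie_bialgebra circ d
    & pre_poisson_compat ast circ D d].

End Bialgebras.

Notation dual_sum k A := (A * dual k A)%type.

(* omega(x + a, y + b) = <x, b> - <a, y> *)
Definition omega_std (k : fieldType) (A : vectType k) :
    'Hom(dual_sum k A, dual k (dual_sum k A)) :=
  linfun2 (fun p q : dual_sum k A => q.2 p.1 - p.2 q.1 : k^o).

Lemma omega_stdE (k : fieldType) (A : vectType k) (p q : dual_sum k A) :
  omega_std A p q = q.2 p.1 - p.2 q.1.
Proof.
rewrite linfun2E //; split=> u c v w /=;
  by rewrite linearP add_lfunE scale_lfunE /= opprD addrACA scalerBr.
Qed.

(* Main.v *)
Require Import Defs.
From mathcomp Require Import all_boot all_order all_algebra.
From mathcomp Require Import ring.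

Set Implicit Arguments.
Unset Strict Implicit.
Unset Printing Implicit Defensive.

Import GRing.Theory.
Local Open Scope ring_scope.

(** The proof rests on two observations about the double A + A*, with star and
    [ , ] denoting the sub-adjacent operations; the four conditions are numbered
    (1) to (4) in the order in which the theorem lists them.

    In a quadratic pre-Poisson algebra, omega(x * y, z) = omega(y, x star z)
    and omega(x o y, z) = - omega(y, [x, z]) say that left multiplications by
    * and o are, up to sign, the omega-adjoints of left multiplications by star
    and [ , ].  Taking adjoints turns each axiom of a Poisson algebra into an
    axiom of a pre-Poisson algebra and conversely, so for products that are
    invariant in this sense the two kinds of structure are equivalent
    ([invariant_pre_poisson], [pre_poisson_subadjacent]).  The actions of
    condition (3) are exactly the ones for which omega is invariant, and their
    symmetrization and antisymmetrization are the operations of condition (2);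
    this gives (2) <-> (3) and (3) -> (1).  For (1) -> (3), invariance also
    yields omega(x * b, c) = omega(c * b, x), so a mixed product is determined
    by the products inside the two isotropic subalgebras ([invariant_unique]).

    For (2) <-> (4) the Poisson axioms on A + A* are expanded by components.
    Axioms with at most one argument, test vector included, from one of the
    two spaces hold because A* and A act on each other as duals of pre-Poisson
    algebras ([pre_poisson_dual_action]).  What is left has two arguments in A
    and two in A*: four equations in A, and the same four with A and A*
    exchanged ([mixed_compat], [poisson_double]).  Testing the equations in A
    against a form d, with parameter c in A*, gives the value of c (x) d on a
    tensor equation, and likewise for the equations in A*.  These are the
    compatibility conditions of a bialgebra ([mixed_compat_tensor],
    [dual_mixed_compat_tensor]).

    To exploit this symmetry, A* is replaced throughout by a space B paired
    perfectly with A, so that a lemma about the A-component of the double also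
    gives its B-component with the two roles exchanged; the last part takes
    B = A*. *)

(** * Linear and bilinear maps *)

Section Linear.
Variable k : fieldType.
Implicit Types U V W : vectType k.

Lemma dual_ext V (v w : V) : (forall u : dual k V, u v = u w) -> v = w.
Proof.
move=> uvw; apply/eqP; rewrite -subr_eq0; apply/eqP/dual_separates => u.
by rewrite linearB /= uvw subrr.
Qed.

Lemma bilinDl U V W (f : 'Hom(U, 'Hom(V, W))) x y z :
  f (x + y) z = f x z + f y z.
Proof. by rewrite linearD add_lfunE. Qed.

Lemma bilinNl U V W (f : 'Hom(U, 'Hom(V, W))) x z : f (- x) z = - f x z.
Proof. by rewrite linearN opp_lfunE. Qed.

Lemma bilin0l U V W (f : 'Hom(U, 'Hom(V, W))) z : f 0 z = 0.
Proof. by rewrite linear0 zero_lfunE. Qed.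

Lemma homD U V (f : 'Hom(U, V)) x y : f (x + y) = f x + f y.
Proof. exact: linearD. Qed.

Lemma homN U V (f : 'Hom(U, V)) x : f (- x) = - f x.
Proof. exact: linearN. Qed.

Lemma bilinDr U V W (f : 'Hom(U, 'Hom(V, W))) x y z :
  f x (y + z) = f x y + f x z.
Proof. exact: linearD. Qed.

Lemma bilinNr U V W (f : 'Hom(U, 'Hom(V, W))) x y : f x (- y) = - f x y.
Proof. exact: linearN. Qed.

Lemma bilin0r U V W (f : 'Hom(U, 'Hom(V, W))) x : f x 0 = 0.
Proof. exact: linear0. Qed.

Definition bilin0E := (bilin0l, bilin0r, addr0, add0r, oppr0, subr0, sub0r).
Definition bilinE := (bilinDl, bilinDr, bilinNl, bilinNr).

Lemma sub_starE V (ast : 'Hom(V, 'End(V))) x y :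
  sub_star ast x y = ast x y + ast y x.
Proof. by rewrite !add_lfunE flipE. Qed.

Lemma sub_bracketE V (circ : 'Hom(V, 'End(V))) x y :
  sub_bracket circ x y = circ x y - circ y x.
Proof. by rewrite add_lfunE add_lfunE !opp_lfunE flipE. Qed.

End Linear.

#[local] Opaque sub_star sub_bracket.

(** * The sub-adjacent Poisson algebra *)

Section Subadjacent.
Variables (k : fieldType) (V : vectType k).
Implicit Types (ast circ : 'Hom(V, 'End(V))).

Lemma sub_star_comm_assoc ast : zinbiel ast -> comm_assoc (sub_star ast).
Proof.
move=> zin; split=> [x y|x y z]; rewrite !sub_starE; first exact: addrC.
rewrite !bilinE !zin.
by apply: dual_ext => u; ring.
Qed.

Lemma sub_bracket_lie circ : pre_lie circ -> lie_bracket (sub_bracket circ).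
Proof.
move=> pl; split=> [x|x y z]; rewrite !sub_bracketE; first exact: subrr.
have e u v w : circ u (circ v w) =
    circ (circ u v) w + circ v (circ u w) - circ (circ v u) w.
  by rewrite -addrA -pl addrC subrK.
rewrite !bilinE (e x y z) (e y z x) (e z x y).
by apply: dual_ext => u; ring.
Qed.

Lemma pre_poisson_subadjacent ast circ :
  pre_poisson ast circ -> poisson (sub_star ast) (sub_bracket circ).
Proof.
case=> zin pl der act; split; first exact: sub_star_comm_assoc.
  exact: sub_bracket_lie.
move=> x y z; rewrite !sub_bracketE !sub_starE act.
rewrite !bilinE.
have e u v w : ast (circ u v) w =
    ast (circ v u) w + circ u (ast v w) - ast v (circ u w).
  by rewrite -addrA -der !bilinE addrC subrK.
rewrite (e z x y) (e z y x).
by apply: dual_ext => u; ring.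
Qed.

End Subadjacent.

(** * Adjoint products for an invariant form *)

Section Invariant.
Variables (k : fieldType) (V : vectType k) (omega : 'Hom(V, dual k V)).
Variables (ast circ : 'Hom(V, 'End(V))).
Hypothesis omega_nondeg : forall x, (forall y, omega x y = 0) -> x = 0.
Hypothesis omega_ast :
  forall x y z, omega (ast x y) z = omega y (sub_star ast x z).
Hypothesis omega_circ :
  forall x y z, omega (circ x y) z = - omega y (sub_bracket circ x z).

Lemma omega_ext x y : (forall z, omega x z = omega y z) -> x = y.
Proof.
move=> xy; apply/eqP; rewrite -subr_eq0; apply/eqP/omega_nondeg => z.
by rewrite !bilinE xy subrr.
Qed.

(** Pairing a pre-Poisson axiom with w and moving all products to the right of
    omega gives the omega-pairing of z with a Poisson identity in x, y, w: the
    Zinbiel identity becomes associativity, the pre-Lie identity becomes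
    Jacobi, and both mixed axioms follow from the Leibniz rule. *)
Lemma invariant_pre_poisson :
  poisson (sub_star ast) (sub_bracket circ) -> pre_poisson ast circ.
Proof.
case=> -[starC starA] [brxx jacobi] leibniz.
have brC x y : sub_bracket circ x y = - sub_bracket circ y x.
  by rewrite !sub_bracketE opprB.
split=> x y z; apply: omega_ext => w.
- by rewrite -bilinDl -sub_starE !omega_ast starA.
- rewrite !bilinE !(omega_ast, omega_circ).
  have := jacobi x y w; rewrite (brC w x) (brC w) bilinE addrAC => /eqP.
  rewrite subr_eq0 (sub_bracketE circ x y) !bilinE => /eqP <-.
  by rewrite !bilinE; ring.
- rewrite -sub_bracketE !bilinE !(omega_ast, omega_circ).
  rewrite leibniz !bilinE; ring.
- rewrite -sub_starE !bilinE !(omega_ast, omega_circ).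
  (* expand [x star y, w] = [x, y star w] + [y, x star w] by Leibniz *)
  rewrite (brC _ w) !leibniz (brC y x) (brC w x) (brC w y).
  rewrite (starC (- _) y) !bilinE.
  by ring.
Qed.
End Invariant.

(** * Poisson structures on a sum of two spaces *)

Lemma alternating_antisym (k : fieldType) (A : vectType k)
    (br : 'Hom(A, 'End(A))) :
  (forall x, br x x = 0) -> forall x y, br x y = - br y x.
Proof.
move=> brxx x y; have := brxx (x + y).
rewrite !bilinE !brxx add0r addr0 => /eqP.
by rewrite addr_eq0 => /eqP.
Qed.

Section FirstComponent.
Variables (k : fieldType) (A B : vectType k).
Variables (mul br : 'Hom(A, 'End(A))) (mul2 br2 : 'Hom(B, 'End(B))).
Variables (P S : 'Hom(B, 'End(A))) (Q M : 'Hom(A, 'End(B))).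

(** (P, S) is a module over the Poisson algebra B, for the star product and the
    bracket respectively. *)
Definition poisson_action : Prop :=
  [/\ forall a b x, P (mul2 a b) x = P a (P b x),
      forall a b x, S (br2 a b) x = S a (S b x) - S b (S a x),
      forall a b x, P (br2 a b) x = S a (P b x) - P b (S a x)
    & forall a b x, S (mul2 a b) x = P a (S b x) + P b (S a x)].

(** On A + B put x star c = P_c x + Q_x c and [c, x] = S_c x - M_x c.  These are
    the A-components of the Poisson axioms with arguments x, y in A and c in B:
    associativity, the Jacobi identity, and the Leibniz rule for the bracket
    with c and with x. *)
Definition mixed_compat : Prop :=
  [/\ forall x y c, P c (mul x y) = mul x (P c y) + P (Q y c) x,
      forall x y c, S c (br x y)
        = br (S c x) y + br x (S c y) - S (M x c) y + S (M y c) x,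
      forall x y c, S c (mul x y)
        = mul (S c x) y + mul x (S c y) - P (M x c) y - P (M y c) x
    & forall x y c, br x (P c y) - S (Q y c) x
        = P c (br x y) - mul y (S c x) + P (M x c) y].

(* The components of the star product and of the bracket on A + B. *)
Let star (p q : A * B) := mul p.1 q.1 + P p.2 q.1 + P q.2 p.1.
Let star2 (p q : A * B) := mul2 p.2 q.2 + Q p.1 q.2 + Q q.1 p.2.
Let bra (p q : A * B) := br p.1 q.1 + S p.2 q.1 - S q.2 p.1.
Let bra2 (p q : A * B) := br2 p.2 q.2 + M p.1 q.2 - M q.1 p.2.

Hypothesis (pois : poisson mul br) (pois2 : poisson mul2 br2).
Hypothesis (act : poisson_action) (compat : mixed_compat).

(** The terms P_{Q_y c} x on the two sides do not match one by one; the first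
    compatibility expresses all of them through P_c (x y), which is symmetric
    in x and y. *)
Lemma double_assoc_fst (p q r : A * B) :
  star p (star q r, star2 q r) = star (star p q, star2 p q) r.
Proof.
case: pois pois2 act compat
  => -[mulC mulA] _ _ [[mul2C _] _ _] [Pm _ _ _] [E1 _ _ _].
have PQ x y c : P (Q y c) x = P c (mul x y) - mul x (P c y).
  by rewrite E1 addrC addKr.
have PC a b x : P a (P b x) = P b (P a x) by rewrite -!Pm mul2C.
case: p q r => [x a] [y b] [z c]; rewrite /star /star2 /=.
rewrite !bilinE !PQ !Pm mulA.
rewrite (PC c a) (PC c b) (mulC z x) (mulC z y).
rewrite (mulC (P a y)) (mulC (P b x)).
apply: dual_ext => u; ring.
Qed.

Lemma double_jacobi_fst (p q r : A * B) :
  bra p (bra q r, bra2 q r) + bra q (bra r p, bra2 r p)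
  + bra r (bra p q, bra2 p q) = 0.
Proof.
case: pois act compat => _ [brxx jac] _ [_ Sb _ _] [_ E3 _ _].
have brC := alternating_antisym brxx.
case: p q r => [x a] [y b] [z c]; rewrite /bra /bra2 /=.
rewrite !bilinE !E3 !Sb.
rewrite (brC (S a y)) (brC (S b z)) (brC (S c x)).
transitivity (br x (br y z) + br y (br z x) + br z (br x y)); last exact: jac.
apply: dual_ext => u; ring.
Qed.

(** As for associativity, the terms S_{Q_y c} x are eliminated. *)
Lemma double_leibniz_fst (p q r : A * B) :
  bra r (star p q, star2 p q) =
  star (bra r p, bra2 r p) q + star p (bra r q, bra2 r q).
Proof.
case: pois act compat => -[mulC _] _ leib [_ _ Pb Sm] [_ _ E5 E6].
have SQ x y c : S (Q y c) x =
    br x (P c y) - (P c (br x y) - mul y (S c x) + P (M x c) y).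
  by rewrite -E6 subKr.
case: p q r => [x a] [y b] [z c]; rewrite /star /star2 /bra /bra2 /=.
rewrite !bilinE !SQ !E5 !Pb !Sm leib (mulC (S a z)).
apply: dual_ext => u; ring.
Qed.

(** Each equation is a Poisson axiom evaluated at two elements of A and one
    of B. *)
Lemma mixed_compat_of_fst :
  (forall p q r : A * B,
     star p (star q r, star2 q r) = star (star p q, star2 p q) r) ->
  (forall p q r : A * B,
     bra p (bra q r, bra2 q r) + bra q (bra r p, bra2 r p)
     + bra r (bra p q, bra2 p q) = 0) ->
  (forall p q r : A * B,
     bra r (star p q, star2 p q) =
     star (bra r p, bra2 r p) q + star p (bra r q, bra2 r q)) ->
  mixed_compat.
Proof.
have brA x y : br x y = - br y x.
  by case: pois => _ [brxx _] _; exact: alternating_antisym.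
rewrite /star /star2 /bra /bra2 => assoc jac leib.
split=> [x y c|x y c|x y c|x y c].
- have := assoc (x, 0) (y, 0) (0, c); rewrite /= !bilin0E.
  by move=> <-.
- have := jac (x, 0) (y, 0) (0, c); rewrite /= !bilin0E !bilinE.
  rewrite (brA y) => /eqP; rewrite addrC addr_eq0 => /eqP ->.
  by apply: dual_ext => u; ring.
- have := leib (x, 0) (y, 0) (0, c); rewrite /= !bilin0E.
  by rewrite !bilinE => ->; apply: dual_ext => u; ring.
- have := leib (y, 0) (0, c) (x, 0); rewrite /= !bilin0E.
  by rewrite !bilinE => ->; apply: dual_ext => u; ring.
Qed.
End FirstComponent.

Section Double.
Variables (k : fieldType) (A B : vectType k).
Variables (mul1 br1 : 'Hom(A, 'End(A))) (mul2 br2 : 'Hom(B, 'End(B))).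
Variables (P S : 'Hom(B, 'End(A))) (Q M : 'Hom(A, 'End(B))).
Hypothesis (pois1 : poisson mul1 br1) (pois2 : poisson mul2 br2).
Hypothesis (act2 : poisson_action mul2 br2 P S).
Hypothesis (act1 : poisson_action mul1 br1 Q M).

Let dstar := sum_prod mul1 mul2 Q Q P P.
Let dbr := sum_prod br1 br2 M (- M) S (- S).

Let dstarE p q : dstar p q =
  (mul1 p.1 q.1 + P p.2 q.1 + P q.2 p.1, mul2 p.2 q.2 + Q p.1 q.2 + Q q.1 p.2).
Proof. exact: sum_prodE. Qed.

Let dbrE p q : dbr p q =
  (br1 p.1 q.1 + S p.2 q.1 - S q.2 p.1, br2 p.2 q.2 + M p.1 q.2 - M q.1 p.2).
Proof. by rewrite /dbr sum_prodE !opp_lfunE. Qed.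

(** The B-components are the A-components after exchanging A and B, hence each
    lemma on first components is used twice. *)
Lemma poisson_double :
  poisson dstar dbr <->
  mixed_compat mul1 br1 P S Q M /\ mixed_compat mul2 br2 Q M P S.
Proof.
split.
  case=> -[_ dA] [_ dJ] dL; split.
    apply: (mixed_compat_of_fst (mul2 := mul2) (br2 := br2)) => // p q r.
    - by have := dA p q r; rewrite !dstarE => -[].
    - by have := dJ p q r; rewrite !dbrE => /(congr1 fst).
    - by have := dL p q r; rewrite !dbrE !dstarE => /(congr1 fst).
  apply: (mixed_compat_of_fst (mul2 := mul1) (br2 := br1))
    => // -[a x] [b y] [c z].
  - by have := dA (x, a) (y, b) (z, c); rewrite !dstarE => -[].
  - by have := dJ (x, a) (y, b) (z, c); rewrite !dbrE => /(congr1 snd).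
  - by have := dL (x, a) (y, b) (z, c); rewrite !dbrE !dstarE => /(congr1 snd).
case=> compat1 compat2; split; first split=> [p q|p q r].
- rewrite !dstarE; case: pois1 pois2 => -[C1 _] _ _ [[C2 _] _ _].
  by rewrite (C1 p.1) (C2 p.2); congr (_, _); rewrite addrAC.
- rewrite !dstarE; apply: injective_projections => /=.
    exact: (double_assoc_fst pois1 pois2 act2 compat1).
  exact: (double_assoc_fst pois2 pois1 act1 compat2
    (p.2, p.1) (q.2, q.1) (r.2, r.1)).
- split=> [p|p q r].
    rewrite dbrE; case: pois1 pois2 => _ [-> _] _ [_ [-> _] _].
    by rewrite !add0r !subrr.
  rewrite !dbrE; apply: injective_projections => /=.
    exact: (double_jacobi_fst pois1 act2 compat1).
  exact: (double_jacobi_fst pois2 act1 compat2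
    (p.2, p.1) (q.2, q.1) (r.2, r.1)).
- move=> p q r; rewrite !dbrE !dstarE; apply: injective_projections => /=.
    exact: (double_leibniz_fst pois1 act2 compat1).
  exact: (double_leibniz_fst pois2 act1 compat2
    (p.2, p.1) (q.2, q.1) (r.2, r.1)).
Qed.
End Double.

(** * The double with its invariant form *)

Section DualActions.
Variables (k : fieldType) (A B : vectType k) (pr : 'Hom(A, 'Hom(B, k^o))).
Hypothesis pr_nondeg : forall x, (forall b, pr x b = 0) -> x = 0.
Variables (ast circ : 'Hom(B, 'End(B))) (P S : 'Hom(B, 'End(A))).
Hypothesis PE : forall a x u, pr (P a x) u = pr x (ast a u).
Hypothesis SE : forall a x u, pr (S a x) u = - pr x (circ a u).

(** The module axioms are the pre-Poisson axioms of B transposed through the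
    pairing. *)
Lemma pre_poisson_dual_action :
  pre_poisson ast circ ->
  poisson_action (sub_star ast) (sub_bracket circ) P S.
Proof.
case=> zin pl der act.
have pr_ext x y : (forall b, pr x b = pr y b) -> x = y.
  move=> xy; apply/eqP; rewrite -subr_eq0; apply/eqP/pr_nondeg => b.
  by rewrite !bilinE xy subrr.
have E3 a b x : P (sub_bracket circ a b) x = S a (P b x) - P b (S a x).
  apply: pr_ext => u; rewrite sub_bracketE !bilinE !(PE, SE) opprK.
  have /(congr1 (pr x)) := der a b u.
  by rewrite !bilinE => ->; rewrite addrC.
split=> // a b x; apply: pr_ext => u.
- by rewrite !PE sub_starE zin bilinDl addrC.
- rewrite sub_bracketE !bilinE !SE !opprK.
  have /(congr1 (pr x)) := pl a b u.
  rewrite !bilinE => /eqP; rewrite subr_eq => /eqP ->.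
  by ring.
- (* the axiom for [a, b] * u makes its right-hand side antisymmetric in a, b *)
  have d : circ a (ast b u) - ast b (circ a u)
           = - (circ b (ast a u) - ast a (circ b u)).
    by rewrite -!der -[in RHS]bilinNl opprB.
  move/(congr1 (pr x)): d; move/(congr1 (pr x)): (act a b u).
  rewrite sub_starE !bilinE !(PE, SE) => e /eqP.
  rewrite subr_eq => /eqP ->; rewrite -opprD e.
  by ring.
Qed.
End DualActions.

Section Pairing.
Variables (k : fieldType) (A B : vectType k) (pr : 'Hom(A, 'Hom(B, k^o))).
Hypothesis pr_nondegl : forall x, (forall b, pr x b = 0) -> x = 0.
Hypothesis pr_nondegr : forall b, (forall x, pr x b = 0) -> b = 0.
Local Notation V := (A * B)%type.

Lemma pr_extl x y : (forall b, pr x b = pr y b) -> x = y.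
Proof.
move=> xy; apply/eqP; rewrite -subr_eq0; apply/eqP/pr_nondegl => b.
by rewrite !bilinE xy subrr.
Qed.

Lemma pr_extr b c : (forall x, pr x b = pr x c) -> b = c.
Proof.
move=> xy; apply/eqP; rewrite -subr_eq0; apply/eqP/pr_nondegr => x.
by rewrite !bilinE xy subrr.
Qed.

Variable omega : 'Hom(V, 'Hom(V, k^o)).
Hypothesis omegaE : forall p q, omega p q = pr p.1 q.2 - pr q.1 p.2.

Lemma omega_nondegenerate p : (forall q, omega p q = 0) -> p = 0.
Proof.
move=> p0; apply: injective_projections => /=.
  apply: pr_nondegl => u; have := p0 (0, u).
  by rewrite omegaE /= bilin0l subr0.
apply: pr_nondegr => x; have := p0 (x, 0).
by rewrite omegaE /= bilin0r sub0r => /eqP; rewrite oppr_eq0 => /eqP.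
Qed.

Lemma omega_antisym p q : omega p q = - omega q p.
Proof. by rewrite !omegaE opprB. Qed.

(** The invariance of * (s = 1) and of o (s = -1) in a common form; it gives
    omega(f p q, r) = s omega(f r q, p).  Pairing a mixed product with an
    element of one of the summands then reduces, by invariance for one summand
    and by this identity for the other, to products inside a summand. *)
Lemma invariant_unique (s : k) (f g : 'Hom(V, 'End(V))) :
  s * s = 1 ->
  (forall p q r,
     omega (f p q) r = s * (omega q (f p r) : k) + omega q (f r p)) ->
  (forall p q r,
     omega (g p q) r = s * (omega q (g p r) : k) + omega q (g r p)) ->
  (forall x y, f (x, 0) (y, 0) = g (x, 0) (y, 0)) ->
  (forall a b, f (0, a) (0, b) = g (0, a) (0, b)) ->
  f = g.
Proof.
move=> ss f_omega g_omega fg1 fg2.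
have splitV (p : V) : p = (p.1, 0) + (0, p.2).
  by apply: injective_projections; rewrite /= ?addr0 ?add0r.
have omega_extr p q : (forall x, omega p (x, 0) = omega q (x, 0)) ->
    (forall a, omega p (0, a) = omega q (0, a)) -> p = q.
  move=> e1 e2; apply/eqP; rewrite -subr_eq0.
  apply/eqP/omega_nondegenerate => r.
  by rewrite (splitV r) !bilinE e1 e2; ring.
have swap (h : 'Hom(V, 'End(V))) :
    (forall p q r,
       omega (h p q) r = s * (omega q (h p r) : k) + omega q (h r p)) ->
    forall p q r, omega (h p q) r = s * (omega (h r q) p : k).
  by move=> h_omega p q r; rewrite !h_omega mulrDr mulrA ss mul1r addrC.
have fg12 x b : f (x, 0) (0, b) = g (x, 0) (0, b).
  apply: omega_extr => [y|c]; first by rewrite f_omega g_omega !fg1.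
  by rewrite (swap f) // (swap g) // fg2.
have fg21 b x : f (0, b) (x, 0) = g (0, b) (x, 0).
  apply: omega_extr => [y|c]; last by rewrite f_omega g_omega !fg2.
  by rewrite (swap f) // (swap g) // fg1.
apply/lfunP => p; apply/lfunP => q; rewrite (splitV p) (splitV q).
by rewrite !bilinE fg1 fg2 fg12 fg21.
Qed.
End Pairing.

Section QuadraticDouble.
Variables (k : fieldType) (A B : vectType k) (pr : 'Hom(A, 'Hom(B, k^o))).
Hypothesis pr_nondegl : forall x, (forall b, pr x b = 0) -> x = 0.
Hypothesis pr_nondegr : forall b, (forall x, pr x b = 0) -> b = 0.
Variables (ast1 circ1 : 'Hom(A, 'End(A))) (ast2 circ2 : 'Hom(B, 'End(B))).
Variables (P S : 'Hom(B, 'End(A))) (Q M : 'Hom(A, 'End(B))).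
Variables (l1 r1 rho1 mu1 : 'Hom(A, 'End(B))).
Variables (l2 r2 rho2 mu2 : 'Hom(B, 'End(A))).

(* The actions in (2) and (3), characterized through the pairing. *)
Hypothesis QE : forall x a y, pr y (Q x a) = pr (ast1 x y) a.
Hypothesis ME : forall x a y, pr y (M x a) = - pr (circ1 x y) a.
Hypothesis PE : forall a x u, pr (P a x) u = pr x (ast2 a u).
Hypothesis SE : forall a x u, pr (S a x) u = - pr x (circ2 a u).
Hypothesis l1E :
  forall x a y, pr y (l1 x a) = pr (ast1 x y) a + pr (ast1 y x) a.
Hypothesis r1E : forall x a y, pr y (r1 x a) = - pr (ast1 y x) a.
Hypothesis rho1E :
  forall x a y, pr y (rho1 x a) = pr (circ1 y x) a - pr (circ1 x y) a.
Hypothesis mu1E : forall x a y, pr y (mu1 x a) = pr (circ1 y x) a.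
Hypothesis l2E :
  forall a x u, pr (l2 a x) u = pr x (ast2 a u) + pr x (ast2 u a).
Hypothesis r2E : forall a x u, pr (r2 a x) u = - pr x (ast2 u a).
Hypothesis rho2E :
  forall a x u, pr (rho2 a x) u = pr x (circ2 u a) - pr x (circ2 a u).
Hypothesis mu2E : forall a x u, pr (mu2 a x) u = pr x (circ2 u a).

Local Notation V := (A * B)%type.
Let dast := sum_prod ast1 ast2 l1 r1 l2 r2.
Let dcirc := sum_prod circ1 circ2 rho1 mu1 rho2 mu2.
Let dstar := sum_prod (sub_star ast1) (sub_star ast2) Q Q P P.
Let dbr := sum_prod (sub_bracket circ1) (sub_bracket circ2) M (- M) S (- S).

Let dastE p q : dast p q =
  (ast1 p.1 q.1 + l2 p.2 q.1 + r2 q.2 p.1,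
   ast2 p.2 q.2 + l1 p.1 q.2 + r1 q.1 p.2).
Proof. exact: sum_prodE. Qed.

Let dcircE p q : dcirc p q =
  (circ1 p.1 q.1 + rho2 p.2 q.1 + mu2 q.2 p.1,
   circ2 p.2 q.2 + rho1 p.1 q.2 + mu1 q.1 p.2).
Proof. exact: sum_prodE. Qed.

Let dstarE p q : dstar p q =
  (sub_star ast1 p.1 q.1 + P p.2 q.1 + P q.2 p.1,
   sub_star ast2 p.2 q.2 + Q p.1 q.2 + Q q.1 p.2).
Proof. exact: sum_prodE. Qed.

Let dbrE p q : dbr p q =
  (sub_bracket circ1 p.1 q.1 + S p.2 q.1 - S q.2 p.1,
   sub_bracket circ2 p.2 q.2 + M p.1 q.2 - M q.1 p.2).
Proof. by rewrite /dbr sum_prodE !opp_lfunE. Qed.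

Lemma sub_star_double : sub_star dast = dstar.
Proof.
apply/lfunP => p; apply/lfunP => q; rewrite sub_starE !dastE dstarE.
apply: injective_projections => /=; rewrite !sub_starE.
  apply: (pr_extl pr_nondegl) => u.
  by rewrite !bilinE 2!l2E 2!r2E 2!PE; ring.
apply: (pr_extr pr_nondegr) => x.
by rewrite !bilinE 2!l1E 2!r1E 2!QE; ring.
Qed.

Lemma sub_bracket_double : sub_bracket dcirc = dbr.
Proof.
apply/lfunP => p; apply/lfunP => q; rewrite sub_bracketE !dcircE dbrE.
apply: injective_projections => /=; rewrite !sub_bracketE.
  apply: (pr_extl pr_nondegl) => u.
  by rewrite !bilinE 2!rho2E 2!mu2E 2!SE; ring.
apply: (pr_extr pr_nondegr) => x.
by rewrite !bilinE 2!rho1E 2!mu1E 2!ME; ring.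
Qed.

Variable omega : 'Hom(V, 'Hom(V, k^o)).
Hypothesis omegaE : forall p q, omega p q = pr p.1 q.2 - pr q.1 p.2.

Lemma omega_double_ast p q r : omega (dast p q) r = omega q (sub_star dast p r).
Proof.
rewrite sub_star_double !omegaE dastE dstarE /= !sub_starE.
by rewrite !bilinE l1E r1E l2E r2E 2!QE 2!PE; ring.
Qed.

Lemma omega_double_circ p q r :
  omega (dcirc p q) r = - omega q (sub_bracket dcirc p r).
Proof.
rewrite sub_bracket_double !omegaE dcircE dbrE /= !sub_bracketE.
by rewrite !bilinE rho1E mu1E rho2E mu2E 2!ME 2!SE; ring.
Qed.

(** Equivalence of (2) and (3): the products of (3) are invariant, with
    symmetrization and antisymmetrization the operations of (2). *)
Lemma pre_poisson_double_iff : pre_poisson dast dcirc <-> poisson dstar dbr.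
Proof.
rewrite -sub_star_double -sub_bracket_double; split.
  exact: pre_poisson_subadjacent.
apply: (invariant_pre_poisson (omega := omega)).
- exact: (omega_nondegenerate pr_nondegl pr_nondegr omegaE).
- exact: omega_double_ast.
- exact: omega_double_circ.
Qed.

(** Equivalence of (1) and (3): the products of (3) solve (1), and there is at
    most one solution. *)
Lemma quadratic_double_iff :
  (exists ast circ : 'Hom(V, 'End(V)),
     [/\ quadratic_pre_poisson ast circ omega,
         forall x y, ast (x, 0) (y, 0) = (ast1 x y, 0)
                     /\ circ (x, 0) (y, 0) = (circ1 x y, 0)
       & forall a b, ast (0, a) (0, b) = (0, ast2 a b)
                     /\ circ (0, a) (0, b) = (0, circ2 a b)])
  <-> pre_poisson dast dcirc.
Proof.
have sub1 x y : dast (x, 0) (y, 0) = (ast1 x y, 0)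
                /\ dcirc (x, 0) (y, 0) = (circ1 x y, 0).
  by rewrite dastE dcircE /= !bilin0E.
have sub2 a b : dast (0, a) (0, b) = (0, ast2 a b)
                /\ dcirc (0, a) (0, b) = (0, circ2 a b).
  by rewrite dastE dcircE /= !bilin0E.
split=> [[ast [circ [[pp _ _ ast_omega circ_omega] s1 s2]]]|pp]; last first.
  exists dast, dcirc; split=> //; split=> //.
  - exact: (omega_nondegenerate pr_nondegl pr_nondegr omegaE).
  - exact: (omega_antisym omegaE).
  - exact: omega_double_ast.
  - exact: omega_double_circ.
suff [<- <-] : ast = dast /\ circ = dcirc by [].
split.
- apply: (invariant_unique pr_nondegl pr_nondegr omegaE (mulr1 1))
    => [p q r|p q r|x y|a b].
  + by rewrite ast_omega sub_starE !bilinE mul1r.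
  + by rewrite omega_double_ast sub_starE !bilinE mul1r.
  + by rewrite (s1 x y).1 (sub1 x y).1.
  + by rewrite (s2 a b).1 (sub2 a b).1.
- apply: (invariant_unique (s := -1) pr_nondegl pr_nondegr omegaE)
    => [|p q r|p q r|x y|a b].
  + by rewrite mulrNN mulr1.
  + by rewrite circ_omega sub_bracketE !bilinE; ring.
  + by rewrite omega_double_circ sub_bracketE !bilinE; ring.
  + by rewrite (s1 x y).2 (sub1 x y).2.
  + by rewrite (s2 a b).2 (sub2 a b).2.
Qed.
End QuadraticDouble.

(** * Tensors and forms on them *)

Section Tensors.
Variable k : fieldType.
Implicit Types U V W : vectType k.

(** Products of coordinate forms read off the entries of a tensor. *)
Lemma tform_ext U V (t s : tensor U V) :
  (forall (a : dual k U) (b : dual k V), tform a b t = tform a b s) -> t = s.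
Proof.
move=> ts; apply/matrixP=> i j.
have crd_lin (W : vectType k) (l : 'I_(\dim {:W})) :
    linear (fun w : W => crd w l : k^o).
  by move=> c x y; rewrite crdP.
pose e (W : vectType k) l : dual k W := linfun (fun w : W => crd w l : k^o).
have eE (W : vectType k) l (w : W) : e W l w = crd w l by rewrite /e linfunP.
have ent_lin : linear (fun t : tensor U V =>
    (t : 'M[k]_(\dim {:U}, \dim {:V})) i j : k^o).
  by move=> c x y; rewrite !mxE.
have entE : tform (e U i) (e V j) = linfun (fun t : tensor U V =>
    (t : 'M[k]_(\dim {:U}, \dim {:V})) i j : k^o).
  by apply: tensor_ext => u v; rewrite tformE !eE linfunP // mxE.
by have := ts (e U i) (e V j); rewrite entE !linfunP.
Qed.

Lemma tform_tau U V (a : dual k V) (b : dual k U) (t : tensor U V) :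
  tform a b (tau U V t) = tform b a t.
Proof.
rewrite -comp_lfunE; congr (fun_of_lfun _ t); apply: tensor_ext => u v.
by rewrite comp_lfunE tauE !tformE mulrC.
Qed.

Lemma tform_map U V U' V' (a : dual k U') (b : dual k V') (f : 'Hom(U, U'))
    (g : 'Hom(V, V')) t :
  tform a b (tmap f g t) = tform (a \o f)%VF (b \o g)%VF t.
Proof.
rewrite -comp_lfunE; congr (fun_of_lfun _ t); apply: tensor_ext => u v.
by rewrite comp_lfunE tmapE !tformE !comp_lfunE.
Qed.

Lemma tformNl U V (a : dual k U) (b : dual k V) t :
  tform (- a) b t = - tform a b t.
Proof.
rewrite -opp_lfunE; congr (fun_of_lfun _ t); apply: tensor_ext => u v.
by rewrite opp_lfunE !tformE opp_lfunE mulNr.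
Qed.

Lemma tformNr U V (a : dual k U) (b : dual k V) t :
  tform a (- b) t = - tform a b t.
Proof.
rewrite -opp_lfunE; congr (fun_of_lfun _ t); apply: tensor_ext => u v.
by rewrite opp_lfunE !tformE opp_lfunE mulrN.
Qed.

Lemma tform_assoc U V W (a : dual k U) (b : dual k V) (c : dual k W)
    (t : tensor U (tensor V W)) :
  tform (tform a b) c (tassoc U V W t) = tform a (tform b c) t.
Proof.
rewrite -comp_lfunE; congr (fun_of_lfun _ t); apply: tensor_ext => u y.
pose T := linfun2 (@tens k U (tensor V W)) u.
have TE z : T z = tens u z by rewrite /T linfun2E //; exact: tens_bilinear.
suff E : ((tform (tform a b) c \o tassoc U V W) \o T
          = tform a (tform b c) \o T)%VF.
  by have := congr1 (fun f : dual k _ => f y) E; rewrite !comp_lfunE TE.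
apply: tensor_ext => v w.
by rewrite !comp_lfunE TE tassocE !tformE mulrA.
Qed.

(** Contracting the last factor with c reduces to the case of two factors. *)
Lemma tform3_ext U V W (t s : tensor (tensor U V) W) :
  (forall (a : dual k U) (b : dual k V) (c : dual k W),
     tform (tform a b) c t = tform (tform a b) c s) -> t = s.
Proof.
move=> ts; apply: tform_ext => u c.
have cl : bilinear_map (fun (x : tensor U V) (w : W) => (c w : k) *: x).
  split=> [x|w] e y z; first by rewrite linearP scalerDl scalerA.
  by rewrite scalerDr !scalerA mulrC.
pose r : 'Hom(tensor (tensor U V) W, tensor U V) :=
  tlift (linfun2 (fun (x : tensor U V) (w : W) => (c w : k) *: x)).
have rE (v : dual k (tensor U V)) y : v (r y) = tform v c y.
  rewrite -comp_lfunE; congr (fun_of_lfun _ y); apply: tensor_ext => x w.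
  by rewrite comp_lfunE tformE /r tliftE (linfun2E cl) linearZ /= mulrC.
by rewrite -!rE; congr (u _); apply: tform_ext => a b; rewrite !rE.
Qed.

End Tensors.

(** * Coalgebras and dual products *)

Section Coalgebra.
Variables (k : fieldType) (A B : vectType k) (ev : 'Hom(B, dual k A)).
Hypothesis ev_surj : forall v, exists b, v = ev b.
Implicit Types (a b c : B) (D d : 'Hom(A, tensor A A)).
Implicit Type F G : 'Hom(A, tensor (tensor A A) A).

(** m is the product dual to D when B is identified with the dual of A. *)
Definition dual_product D (m : 'Hom(B, 'End(B))) : Prop :=
  forall a b x, ev (m a b) x = tform (ev a) (ev b) (D x).

Lemma dual_product_comp D m a b :
  dual_product D m -> (tform (ev a) (ev b) \o D)%VF = ev (m a b).
Proof. by move=> mE; apply/lfunP => x; rewrite mE comp_lfunE. Qed.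

Lemma tform_ev_ext (t s : tensor A A) :
  (forall a b, tform (ev a) (ev b) t = tform (ev a) (ev b) s) -> t = s.
Proof.
move=> ts; apply: tform_ext => u v.
by have [[a ->] [b ->]] := (ev_surj u, ev_surj v).
Qed.

Lemma tform3_ev_ext F G :
  (forall a b c x, tform (tform (ev a) (ev b)) (ev c) (F x)
                   = tform (tform (ev a) (ev b)) (ev c) (G x)) -> F = G.
Proof.
move=> FG; apply/lfunP => x; apply: tform3_ext => u v w.
by have [[a ->] [[b ->] [c ->]]] := (ev_surj u, (ev_surj v, ev_surj w)).
Qed.

Lemma tform3_coprodl D d m n a b c x :
  dual_product D m -> dual_product d n ->
  tform (tform (ev a) (ev b)) (ev c) ((tmap D \1 \o d)%VF x)
  = ev (n (m a b) c) x.
Proof.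
move=> mE nE; rewrite comp_lfunE tform_map comp_lfun1r.
by rewrite (dual_product_comp _ _ mE) nE.
Qed.

Lemma tform3_coprodr D d m n a b c x :
  dual_product D m -> dual_product d n ->
  tform (tform (ev a) (ev b)) (ev c)
    (((tassoc A A A \o tmap \1 D) \o d)%VF x)
  = ev (n a (m b c)) x.
Proof.
move=> mE nE; rewrite !comp_lfunE tform_assoc tform_map comp_lfun1r.
by rewrite (dual_product_comp _ _ mE) nE.
Qed.

Lemma tform3_tau12 F a b c x :
  tform (tform (ev a) (ev b)) (ev c) ((tmap (tau A A) \1 \o F)%VF x)
  = tform (tform (ev b) (ev a)) (ev c) (F x).
Proof.
rewrite comp_lfunE tform_map comp_lfun1r; congr (tform _ (ev c) _).
by apply/lfunP => y; rewrite comp_lfunE tform_tau.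
Qed.

Lemma tform3D F G a b c x :
  tform (tform (ev a) (ev b)) (ev c) ((F + G) x)
  = tform (tform (ev a) (ev b)) (ev c) (F x)
    + tform (tform (ev a) (ev b)) (ev c) (G x).
Proof. by rewrite add_lfunE homD. Qed.

Lemma tform3B F G a b c x :
  tform (tform (ev a) (ev b)) (ev c) ((F - G) x)
  = tform (tform (ev a) (ev b)) (ev c) (F x)
    - tform (tform (ev a) (ev b)) (ev c) (G x).
Proof. by rewrite tform3D opp_lfunE homN. Qed.

Lemma dual_product_sub_star D m :
  dual_product D m -> dual_product (D + (tau A A \o D))%VF (sub_star m).
Proof.
move=> mE a b x; rewrite sub_starE bilinDl !mE add_lfunE comp_lfunE homD.
by rewrite tform_tau.
Qed.

Lemma dual_product_sub_bracket D m :
  dual_product D m -> dual_product (D - (tau A A \o D))%VF (sub_bracket m).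
Proof.
move=> mE a b x; rewrite sub_bracketE !bilinE !mE.
by rewrite add_lfunE opp_lfunE comp_lfunE homD homN tform_tau.
Qed.

(** Evaluated at a (x) b (x) c, a coalgebra axiom is the algebra axiom for
    a, b, c applied to x. *)
Lemma pre_poisson_dual_coalgebra D d m n :
  dual_product D m -> dual_product d n ->
  pre_poisson m n -> pre_poisson_coalgebra D d.
Proof.
move=> mE nE [zin pl der act].
have sE := dual_product_sub_star mE; have bE := dual_product_sub_bracket nE.
split; apply: tform3_ev_ext => a b c x.
- rewrite tform3D tform3_tau12 !(tform3_coprodl _ _ _ _ mE mE).
  rewrite (tform3_coprodr _ _ _ _ mE mE) zin bilinDl.
  exact: addrC.
- rewrite tform3_tau12 !tform3B !(tform3_coprodl _ _ _ _ nE nE).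
  rewrite !(tform3_coprodr _ _ _ _ nE nE).
  have := congr1 (fun u => ev u x) (pl a b c); rewrite !bilinE => e.
  by apply/eqP; rewrite -eqr_opp !opprB; apply/eqP.
- rewrite tform3B tform3_tau12 (tform3_coprodl _ _ _ _ bE mE).
  rewrite (tform3_coprodr _ _ _ _ mE nE) (tform3_coprodr _ _ _ _ nE mE).
  by rewrite sub_bracketE der !bilinE.
- rewrite tform3D tform3_tau12 (tform3_coprodl _ _ _ _ sE nE).
  rewrite !(tform3_coprodr _ _ _ _ nE mE).
  by rewrite sub_starE act !bilinE.
Qed.

End Coalgebra.

(** * The bialgebra equations *)

(** Two equations whose sides differ by the same amount, or below by opposite
    amounts, are equivalent; the premise is left to ring. *)
Lemma eq_transport (V : zmodType) (a b a' b' : V) :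
  a - b = a' - b' -> a = b -> a' = b'.
Proof.
by move=> + ab; rewrite ab subrr => /esym/eqP; rewrite subr_eq0 => /eqP.
Qed.

Lemma eq_transportN (V : zmodType) (a b a' b' : V) :
  a - b = b' - a' -> a = b -> a' = b'.
Proof.
by move=> + ab; rewrite ab subrr => /esym/eqP; rewrite subr_eq0 => /eqP ->.
Qed.

(** The two expressions required for D(x * y) + tau D(x * y) in a Zinbiel
    bialgebra are exchanged by tau, which fixes the left-hand side. *)
Lemma zinbiel_compat_sym (k : fieldType) (A : vectType k)
    (ast : 'Hom(A, 'End(A))) (D : 'Hom(A, tensor A A)) :
  (forall x y, D (ast x y) + tau A A (D (ast x y))
     = tmap \1%VF (ast x) (D y) + tau A A (tmap (ast x) \1%VF (D y))
       + tau A A (tmap \1%VF (flip ast y) (D x))) ->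
  forall x y, D (ast x y) + tau A A (D (ast x y))
     = tmap \1%VF (flip ast y) (D x) + tmap (ast x) \1%VF (D y)
       + tau A A (tmap \1%VF (ast x) (D y)).
Proof.
move=> compat x y; apply: tform_ext => a b.
have := congr1 (tform b a) (compat x y).
rewrite !homD !tform_tau.
by apply: eq_transport; ring.
Qed.

Section Bialgebra.
Variables (k : fieldType) (A B : vectType k) (ev : 'Hom(B, dual k A)).
Hypothesis ev_surj : forall v, exists b, v = ev b.
Hypothesis ev_inj : forall b, ev b = 0 -> b = 0.
Local Notation I := (\1%VF : 'End(A)).
Local Notation T := (tau A A).
Variables (ast circ : 'Hom(A, 'End(A))) (D d : 'Hom(A, tensor A A)).
Variables (ast2 circ2 : 'Hom(B, 'End(B))).
Variables (P S : 'Hom(B, 'End(A))) (Q M : 'Hom(A, 'End(B))).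
Hypothesis ast2E : dual_product ev D ast2.
Hypothesis circ2E : dual_product ev d circ2.
Hypothesis PE : forall a x (v : dual k A), v (P a x) = tform (ev a) v (D x).
Hypothesis SE : forall a x (v : dual k A), v (S a x) = - tform (ev a) v (d x).
Hypothesis QE : forall x a, ev (Q x a) = (ev a \o ast x)%VF.
Hypothesis ME : forall x a, ev (M x a) = - (ev a \o circ x)%VF.

Let star2 := sub_star ast2.
Let br2 := sub_bracket circ2.
Let star := sub_star ast.
Let br := sub_bracket circ.

Let tform_mapl (u v : dual k A) (h : 'End(A)) t :
  tform u v (tmap h I t) = tform (u \o h)%VF v t.
Proof. by rewrite tform_map comp_lfun1r. Qed.

Let tform_mapr (u v : dual k A) (h : 'End(A)) t :
  tform u v (tmap I h t) = tform u (v \o h)%VF t.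
Proof. by rewrite tform_map comp_lfun1r. Qed.

(* Dictionary between the terms of the equations in A, tested by a form v, and
   the values of a (x) v on tensors. *)
Let P_map a (v : dual k A) (h : 'End(A)) x :
  v (h (P a x)) = tform (ev a) v (tmap I h (D x)).
Proof. by rewrite tform_mapr -PE comp_lfunE. Qed.

Let S_map a (v : dual k A) (h : 'End(A)) x :
  v (h (S a x)) = - tform (ev a) v (tmap I h (d x)).
Proof. by rewrite tform_mapr -SE comp_lfunE. Qed.

Let PQ a (v : dual k A) x y :
  v (P (Q y a) x) = tform (ev a) v (tmap (ast y) I (D x)).
Proof. by rewrite PE tform_mapl QE. Qed.

Let PM a (v : dual k A) x y :
  v (P (M y a) x) = - tform (ev a) v (tmap (circ y) I (D x)).
Proof. by rewrite PE tform_mapl ME tformNl. Qed.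

Let SQ a (v : dual k A) x y :
  v (S (Q y a) x) = - tform (ev a) v (tmap (ast y) I (d x)).
Proof. by rewrite SE tform_mapl QE. Qed.

Let SM a (v : dual k A) x y :
  v (S (M y a) x) = tform (ev a) v (tmap (circ y) I (d x)).
Proof. by rewrite SE tform_mapl ME tformNl opprK. Qed.

(** The equations in A are those among the bialgebra conditions that do not
    involve the flip. *)
Lemma mixed_compat_tensor :
  mixed_compat star br P S Q M <->
  [/\ forall x y, D (star x y)
        = tmap (ast x) I (D y) + tmap I (star y) (D x),
      forall x y, d (circ x y - circ y x)
        = tmap (circ x) I (d y) + tmap I (br x) (d y)
          - tmap (circ y) I (d x) - tmap I (br y) (d x),
      forall x y, d (star x y)
        = tmap I (star x) (d y) + tmap I (star y) (d x)
          - tmap (circ x) I (D y) - tmap (circ y) I (D x)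
    & forall x y, D (br x y)
        = tmap (circ x) I (D y) - tmap I (star y) (d x)
          + tmap (ast y) I (d x) + tmap I (br x) (D y)].
Proof.
have starC x y : star x y = star y x by rewrite /star !sub_starE addrC.
have brC x y : br x y = - br y x by rewrite /br !sub_bracketE opprB.
split=> -[E1 E2 E3 E4]; split.
- move=> x y; apply: (tform_ev_ext ev_surj) => a b.
  have := congr1 (ev b) (E1 y x a).
  rewrite !homD P_map PQ PE starC.
  by apply: eq_transport; ring.
- move=> x y; apply: (tform_ev_ext ev_surj) => a b; rewrite -sub_bracketE.
  have := congr1 (ev b) (E2 x y a).
  rewrite (brC (S a x)) !homD !homN !S_map !SM SE.
  by apply: eq_transportN; ring.
- move=> x y; apply: (tform_ev_ext ev_surj) => a b.
  have := congr1 (ev b) (E3 x y a).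
  rewrite (starC (S a x)) !homD !homN !S_map !PM SE.
  by apply: eq_transportN; ring.
- move=> x y; apply: (tform_ev_ext ev_surj) => a b.
  have := congr1 (ev b) (E4 x y a).
  rewrite !homD !homN P_map S_map SQ PM PE.
  by apply: eq_transportN; ring.
- move=> x y a; apply: dual_ext => v.
  have := congr1 (tform (ev a) v) (E1 y x).
  rewrite !homD P_map PQ PE starC.
  by apply: eq_transport; ring.
- move=> x y a; apply: dual_ext => v.
  have := congr1 (tform (ev a) v) (E2 x y); rewrite -sub_bracketE.
  rewrite (brC (S a x)) !homD !homN !S_map !SM SE.
  by apply: eq_transportN; ring.
- move=> x y a; apply: dual_ext => v.
  have := congr1 (tform (ev a) v) (E3 x y).
  rewrite (starC (S a x)) !homD !homN !S_map !PM SE.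
  by apply: eq_transportN; ring.
- move=> x y a; apply: dual_ext => v.
  have := congr1 (tform (ev a) v) (E4 x y).
  rewrite !homD !homN P_map S_map SQ PM PE.
  by apply: eq_transportN; ring.
Qed.

(* The same dictionary for the equations in B, evaluated at w in A. *)
Let Qv x a w : ev (Q x a) w = ev a (ast x w).
Proof. by rewrite QE comp_lfunE. Qed.

Let Mv x a w : ev (M x a) w = - ev a (circ x w).
Proof. by rewrite ME opp_lfunE comp_lfunE. Qed.

Let tQl x a v t : tform (ev (Q x a)) v t = tform (ev a) v (tmap (ast x) I t).
Proof. by rewrite tform_mapl QE. Qed.

Let tQr x v b t : tform v (ev (Q x b)) t = tform v (ev b) (tmap I (ast x) t).
Proof. by rewrite tform_mapr QE. Qed.

Let tMl x a v t :
  tform (ev (M x a)) v t = - tform (ev a) v (tmap (circ x) I t).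
Proof. by rewrite tform_mapl ME tformNl. Qed.

Let tMr x v b t :
  tform v (ev (M x b)) t = - tform v (ev b) (tmap I (circ x) t).
Proof. by rewrite tform_mapr ME tformNr. Qed.

Let QP a x b w :
  ev (Q (P a x) b) w = tform (ev a) (ev b) (tmap I (flip ast w) (D x)).
Proof. by rewrite Qv -(flipE ast) P_map. Qed.

Let QS a x b w :
  ev (Q (S a x) b) w = - tform (ev a) (ev b) (tmap I (flip ast w) (d x)).
Proof. by rewrite Qv -(flipE ast) S_map. Qed.

Let MP a x b w :
  ev (M (P a x) b) w = - tform (ev a) (ev b) (tmap I (flip circ w) (D x)).
Proof. by rewrite Mv -(flipE circ) P_map. Qed.

Let MS a x b w :
  ev (M (S a x) b) w = tform (ev a) (ev b) (tmap I (flip circ w) (d x)).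
Proof. by rewrite Mv -(flipE circ) S_map opprK. Qed.

Let star2E a b x : ev (star2 a b) x
  = tform (ev a) (ev b) (D x) + tform (ev b) (ev a) (D x).
Proof. by rewrite /star2 sub_starE bilinDl !ast2E. Qed.

Let br2E a b x : ev (br2 a b) x
  = tform (ev a) (ev b) (d x) - tform (ev b) (ev a) (d x).
Proof. by rewrite /br2 sub_bracketE !bilinE !circ2E. Qed.

(** An equation in B, evaluated at w, has two parameters a and b in B; the flip
    collects the terms in which b comes to stand in the first tensor factor. *)
Lemma dual_mixed_compat_tensor :
  mixed_compat star2 br2 Q M P S <->
  [/\ forall x y, D (ast x y) + T (D (ast x y))
        = tmap I (ast x) (D y) + T (tmap (ast x) I (D y))
          + T (tmap I (flip ast y) (D x)),
      forall x y, (\1 - T)%VF (d (circ x y))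
        = (\1 - T)%VF (tmap I (flip circ y) (d x) + tmap (circ x) I (d y)
                       + tmap I (circ x) (d y)),
      forall x y, D (circ x y) + T (D (circ x y))
        = tmap (circ x) I (D y) + T (tmap (circ x) I (D y))
          + tmap I (circ x) (D y) + T (tmap I (circ x) (D y))
          - tmap I (flip ast y) (d x) - T (tmap I (flip ast y) (d x))
    & forall x y, d (ast x y) - T (d (ast x y))
        = tmap I (ast x) (d y) - T (tmap (ast x) I (d y))
          - tmap (circ x) I (D y) - T (tmap I (circ x) (D y))
          + tmap I (flip ast y) (d x) + T (tmap I (flip circ y) (D x))].
Proof.
have ev_ext u v : (forall y, ev u y = ev v y) -> u = v.
  move=> uv; apply/eqP; rewrite -subr_eq0; apply/eqP/ev_inj/lfunP => y.
  by rewrite !bilinE uv subrr zero_lfunE.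
have TE t : (\1 - T)%VF t = t - T t by rewrite add_lfunE opp_lfunE id_lfunE.
split=> -[E1 E2 E3 E4]; split.
- move=> x y; apply: (tform_ev_ext ev_surj) => a b.
  have := congr1 (fun u => ev u y) (E1 a b x).
  rewrite bilinDl QP Qv !star2E tQl tQr !homD !tform_tau.
  by apply: eq_transport; ring.
- move=> x y; apply: (tform_ev_ext ev_surj) => a b; rewrite !TE.
  have := congr1 (fun u => ev u y) (E2 a b x).
  rewrite !bilinE 2!MS Mv 3!br2E 2!tMl 2!tMr.
  rewrite !homD !homN !homD !tform_tau.
  by apply: eq_transportN; ring.
- move=> x y; apply: (tform_ev_ext ev_surj) => a b.
  have := congr1 (fun u => ev u y) (E3 a b x).
  rewrite !bilinE 2!QS Mv 3!star2E 2!tMl 2!tMr.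
  rewrite !homD !homN !tform_tau.
  by apply: eq_transportN; ring.
- move=> x y; apply: (tform_ev_ext ev_surj) => a b.
  have := congr1 (fun u => ev u y) (E4 a b x).
  rewrite !bilinE MP QS Qv star2E !br2E tMl tMr tQl tQr.
  rewrite !homD !homN !tform_tau.
  by apply: eq_transportN; ring.
- move=> a b x; apply: ev_ext => y.
  have := congr1 (tform (ev a) (ev b)) (E1 x y).
  rewrite bilinDl QP Qv !star2E tQl tQr !homD !tform_tau.
  by apply: eq_transport; ring.
- move=> a b x; apply: ev_ext => y.
  have := congr1 (tform (ev a) (ev b)) (E2 x y); rewrite !TE.
  rewrite !bilinE 2!MS Mv 3!br2E 2!tMl 2!tMr.
  rewrite !homD !homN !homD !tform_tau.
  by apply: eq_transportN; ring.
- move=> a b x; apply: ev_ext => y.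
  have := congr1 (tform (ev a) (ev b)) (E3 x y).
  rewrite !bilinE 2!QS Mv 3!star2E 2!tMl 2!tMr.
  rewrite !homD !homN !tform_tau.
  by apply: eq_transportN; ring.
- move=> a b x; apply: ev_ext => y.
  have := congr1 (tform (ev a) (ev b)) (E4 x y).
  rewrite !bilinE MP QS Qv star2E !br2E tMl tMr tQl tQr.
  rewrite !homD !homN !tform_tau.
  by apply: eq_transportN; ring.
Qed.

End Bialgebra.

(** * The equivalences for a perfect pairing *)

Section PerfectPairing.
Variables (k : fieldType) (A B : vectType k) (ev : 'Hom(B, dual k A)).
Hypothesis ev_surj : forall v, exists b, v = ev b.
Hypothesis ev_inj : forall b, ev b = 0 -> b = 0.
Variables (ast1 circ1 : 'Hom(A, 'End(A))) (ast2 circ2 : 'Hom(B, 'End(B))).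
Variables (D d : 'Hom(A, tensor A A)).
Hypothesis ast2E : dual_product ev D ast2.
Hypothesis circ2E : dual_product ev d circ2.

Variables (P S l2 r2 rho2 mu2 : 'Hom(B, 'End(A))).
Variables (Q M l1 r1 rho1 mu1 : 'Hom(A, 'End(B))).
Hypothesis QE : forall x a y, ev (Q x a) y = ev a (ast1 x y).
Hypothesis ME : forall x a y, ev (M x a) y = - ev a (circ1 x y).
Hypothesis PE : forall a x b, ev b (P a x) = ev (ast2 a b) x.
Hypothesis SE : forall a x b, ev b (S a x) = - ev (circ2 a b) x.
Hypothesis l1E :
  forall x a y, ev (l1 x a) y = ev a (ast1 x y) + ev a (ast1 y x).
Hypothesis r1E : forall x a y, ev (r1 x a) y = - ev a (ast1 y x).
Hypothesis rho1E :
  forall x a y, ev (rho1 x a) y = ev a (circ1 y x) - ev a (circ1 x y).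
Hypothesis mu1E : forall x a y, ev (mu1 x a) y = ev a (circ1 y x).
Hypothesis l2E :
  forall a x b, ev b (l2 a x) = ev (ast2 a b) x + ev (ast2 b a) x.
Hypothesis r2E : forall a x b, ev b (r2 a x) = - ev (ast2 b a) x.
Hypothesis rho2E :
  forall a x b, ev b (rho2 a x) = ev (circ2 b a) x - ev (circ2 a b) x.
Hypothesis mu2E : forall a x b, ev b (mu2 a x) = ev (circ2 b a) x.

Variable omega : 'Hom((A * B)%type, dual k (A * B)%type).
Hypothesis omegaE : forall p q, omega p q = ev q.2 p.1 - ev p.2 q.1.
Hypothesis pp1 : pre_poisson ast1 circ1.
Hypothesis pp2 : pre_poisson ast2 circ2.

(* The pairing of A and B, seen from A. *)
Let pr := flip ev.

Let pr_nondegl x : (forall b, pr x b = 0) -> x = 0.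
Proof.
move=> x0; apply: dual_separates => v; have [b ->] := ev_surj v.
by rewrite -(flipE ev).
Qed.

Let pr_nondegr b : (forall x, pr x b = 0) -> b = 0.
Proof.
by move=> b0; apply/ev_inj/lfunP => x; rewrite -(flipE ev) b0 zero_lfunE.
Qed.

Let dstar := sum_prod (sub_star ast1) (sub_star ast2) Q Q P P.
Let dbr := sum_prod (sub_bracket circ1) (sub_bracket circ2) M (- M) S (- S).
Let dast := sum_prod ast1 ast2 l1 r1 l2 r2.
Let dcirc := sum_prod circ1 circ2 rho1 mu1 rho2 mu2.

Let quadratic_iff :
  (exists ast circ : 'Hom((A * B)%type, 'End((A * B)%type)),
     [/\ quadratic_pre_poisson ast circ omega,
         forall x y, ast (x, 0) (y, 0) = (ast1 x y, 0)
                     /\ circ (x, 0) (y, 0) = (circ1 x y, 0)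
       & forall a b, ast (0, a) (0, b) = (0, ast2 a b)
                     /\ circ (0, a) (0, b) = (0, circ2 a b)])
  <-> pre_poisson dast dcirc.
Proof.
by apply: (quadratic_double_iff (Q := Q) (M := M) (P := P) (S := S)
  pr_nondegl pr_nondegr) => *; rewrite !flipE //.
Qed.

Let poisson_iff : pre_poisson dast dcirc <-> poisson dstar dbr.
Proof.
apply: (pre_poisson_double_iff pr_nondegl pr_nondegr) => *;
  by rewrite ?flipE ?omegaE.
Qed.

Let mixed_compat_iff :
  poisson dstar dbr <->
  mixed_compat (sub_star ast1) (sub_bracket circ1) P S Q M
  /\ mixed_compat (sub_star ast2) (sub_bracket circ2) Q M P S.
Proof.
apply: poisson_double; try exact: pre_poisson_subadjacent.
  by apply: (pre_poisson_dual_action pr_nondegl) => // *; rewrite !flipE.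
by apply: (pre_poisson_dual_action (pr := ev)) => // b b0; apply/ev_inj/lfunP
  => x; rewrite b0 zero_lfunE.
Qed.

Let bialgebra_iff :
  mixed_compat (sub_star ast1) (sub_bracket circ1) P S Q M
  /\ mixed_compat (sub_star ast2) (sub_bracket circ2) Q M P S
  <-> pre_poisson_bialgebra ast1 circ1 D d.
Proof.
have tPE a x (v : dual k A) : v (P a x) = tform (ev a) v (D x).
  by have [b ->] := ev_surj v; rewrite PE ast2E.
have tSE a x (v : dual k A) : v (S a x) = - tform (ev a) v (d x).
  by have [b ->] := ev_surj v; rewrite SE circ2E.
have cQE x a : ev (Q x a) = (ev a \o ast1 x)%VF.
  by apply/lfunP => y; rewrite QE comp_lfunE.
have cME x a : ev (M x a) = - (ev a \o circ1 x)%VF.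
  by apply/lfunP => y; rewrite ME opp_lfunE comp_lfunE.
rewrite (mixed_compat_tensor ev_surj tPE tSE cQE cME).
rewrite (dual_mixed_compat_tensor ev_surj ev_inj ast2E circ2E tPE tSE cQE cME).
have coalg := pre_poisson_dual_coalgebra ev_surj ast2E circ2E pp2.
split=> [[[Z3 L1 C1 C2] [Z1 L2 C4 C3]]|[_ _ zin lie comp]].
  have [[zin pl _ _] [zinc plc _ _]] := (pp1, coalg).
  split=> //; split=> //.
  exact: zinbiel_compat_sym.
case: zin lie comp => _ _ Z1 _ Z3 [_ _ L1 L2] [C1 C2 C3 C4].
by split; split.
Qed.

Lemma perfect_pairing_equivalences :
  [<-> (exists ast circ : 'Hom((A * B)%type, 'End((A * B)%type)),
          [/\ quadratic_pre_poisson ast circ omega,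
              forall x y, ast (x, 0) (y, 0) = (ast1 x y, 0)
                          /\ circ (x, 0) (y, 0) = (circ1 x y, 0)
            & forall a b, ast (0, a) (0, b) = (0, ast2 a b)
                          /\ circ (0, a) (0, b) = (0, circ2 a b)]);
       matched_poisson
         (sub_star ast1) (sub_bracket circ1) (sub_star ast2) (sub_bracket circ2)
         Q M P S;
       matched_pre_poisson ast1 circ1 ast2 circ2 l1 r1 rho1 mu1 l2 r2 rho2 mu2;
       pre_poisson_bialgebra ast1 circ1 D d].
Proof.
have sub1 := pre_poisson_subadjacent pp1.
have sub2 := pre_poisson_subadjacent pp2.
tfae.
- by move=> /quadratic_iff/poisson_iff pois; split.
- by case=> _ _ pois; split=> //; apply/poisson_iff.
- by case=> _ _ /poisson_iff/mixed_compat_iff/bialgebra_iff.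
- by move=> /bialgebra_iff/mixed_compat_iff/poisson_iff/quadratic_iff.
Qed.
End PerfectPairing.

(** * The dual space *)

Section StandardActions.
Variables (k : fieldType) (A : vectType k).
Implicit Types (h : 'Hom(A, 'End(A))) (m : 'Hom(dual k A, 'End(dual k A))).
Implicit Types (a b : dual k A) (x y : A).

Lemma hom2B (U V W : vectType k) (f g : 'Hom(U, 'Hom(V, W))) (x : U) (y : V) :
  (f - g) x y = f x y - g x y.
Proof. by rewrite !add_lfunE !opp_lfunE. Qed.

Lemma hom2opp (U V W : vectType k) (f : 'Hom(U, 'Hom(V, W))) (x : U) (y : V) :
  (- f) x y = - f x y.
Proof. by rewrite !opp_lfunE. Qed.

Lemma hom3B (U V W X : vectType k) (f g : 'Hom(U, 'Hom(V, 'Hom(W, X))))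
    (x : U) (y : V) z :
  (f - g) x y z = f x y z - g x y z.
Proof. by rewrite !hom2B add_lfunE opp_lfunE. Qed.

Lemma hom3opp (U V W X : vectType k) (f : 'Hom(U, 'Hom(V, 'Hom(W, X))))
    (x : U) (y : V) z :
  (- f) x y z = - f x y z.
Proof. by rewrite hom2opp opp_lfunE. Qed.

Lemma dual_actN h x a y : (- dual_act h) x a y = a (h x y).
Proof. by rewrite hom3opp dual_actE opprK. Qed.

Lemma predual_actN m a x b : b ((- predual_act m) a x) = m a b x.
Proof. by rewrite hom2opp homN predual_actE opprK. Qed.

Lemma dual_act_flip h x a y : dual_act (flip h) x a y = - a (h y x).
Proof. by rewrite dual_actE flipE. Qed.

Lemma dual_actN_flip h x a y : (- dual_act (flip h)) x a y = a (h y x).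
Proof. by rewrite dual_actN flipE. Qed.

Lemma dual_actB_flip h x a y :
  (dual_act h - dual_act (flip h)) x a y = a (h y x) - a (h x y).
Proof. by rewrite hom3B !dual_actE flipE opprK addrC. Qed.

Lemma dual_actNB_flip h x a y :
  (- dual_act h - dual_act (flip h)) x a y = a (h x y) + a (h y x).
Proof. by rewrite hom3B dual_actN dual_actE flipE opprK. Qed.

(** Right multiplications enter as left multiplications of the opposite
    product m'. *)
Section Opposite.
Variables m m' : 'Hom(dual k A, 'End(dual k A)).
Hypothesis m'E : forall a b, m' b a = m a b.

Lemma predual_act_opp a x b : b (predual_act m' a x) = - m b a x.
Proof. by rewrite predual_actE m'E. Qed.

Lemma predual_actN_opp a x b : b ((- predual_act m') a x) = m b a x.
Proof. by rewrite predual_actN m'E. Qed.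

Lemma predual_actB_opp a x b :
  b ((predual_act m - predual_act m') a x) = m b a x - m a b x.
Proof. by rewrite hom2B homD homN !predual_actE m'E opprK addrC. Qed.

Lemma predual_actNB_opp a x b :
  b ((- predual_act m - predual_act m') a x) = m a b x + m b a x.
Proof. by rewrite hom2B homD homN predual_actN predual_actE m'E opprK. Qed.
End Opposite.

Lemma predual_act_flip m a x b : b (predual_act (flip m) a x) = - m b a x.
Proof. exact (predual_act_opp (flipE m) a x b). Qed.

Lemma predual_actN_flip m a x b : b ((- predual_act (flip m)) a x) = m b a x.
Proof. exact (predual_actN_opp (flipE m) a x b). Qed.

Lemma predual_actB_flip m a x b :
  b ((predual_act m - predual_act (flip m)) a x) = m b a x - m a b x.
Proof. exact (predual_actB_opp (flipE m) a x b). Qed.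

Lemma predual_actNB_flip m a x b :
  b ((- predual_act m - predual_act (flip m)) a x) = m a b x + m b a x.
Proof. exact (predual_actNB_opp (flipE m) a x b). Qed.

End StandardActions.

Section DualMain.
Variables (k : fieldType) (A : vectType k).
Local Notation dA := (dual k A).
Variables (ast1 circ1 : 'Hom(A, 'End(A))) (D d : 'Hom(A, tensor A A)).
Variables (P S l2 r2 rho2 mu2 : 'Hom(dA, 'End(A))).
Variables (Q M l1 r1 rho1 mu1 : 'Hom(A, 'End(dA))).
Let ast2 := dual_prod D.
Let circ2 := dual_prod d.
Hypothesis QE : forall x (a : dA) y, Q x a y = a (ast1 x y).
Hypothesis ME : forall x (a : dA) y, M x a y = - a (circ1 x y).
Hypothesis PE : forall (a : dA) x (b : dA), b (P a x) = ast2 a b x.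
Hypothesis SE : forall (a : dA) x (b : dA), b (S a x) = - circ2 a b x.
Hypothesis l1E :
  forall x (a : dA) y, l1 x a y = a (ast1 x y) + a (ast1 y x).
Hypothesis r1E : forall x (a : dA) y, r1 x a y = - a (ast1 y x).
Hypothesis rho1E :
  forall x (a : dA) y, rho1 x a y = a (circ1 y x) - a (circ1 x y).
Hypothesis mu1E : forall x (a : dA) y, mu1 x a y = a (circ1 y x).
Hypothesis l2E :
  forall (a : dA) x (b : dA), b (l2 a x) = ast2 a b x + ast2 b a x.
Hypothesis r2E : forall (a : dA) x (b : dA), b (r2 a x) = - ast2 b a x.
Hypothesis rho2E :
  forall (a : dA) x (b : dA), b (rho2 a x) = circ2 b a x - circ2 a b x.
Hypothesis mu2E : forall (a : dA) x (b : dA), b (mu2 a x) = circ2 b a x.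
Hypothesis pp1 : pre_poisson ast1 circ1.
Hypothesis pp2 : pre_poisson ast2 circ2.

Let evE (a : dA) : (\1%VF : 'End(dA)) a = a.
Proof. by rewrite id_lfunE. Qed.

(** The case B = A* of the previous equivalences, with the identification of B
    and A* the identity. *)
Lemma dual_equivalences :
  [<-> (exists ast circ : 'Hom(dual_sum k A, 'End(dual_sum k A)),
          [/\ quadratic_pre_poisson ast circ (omega_std A),
              forall x y : A, ast (x, 0) (y, 0) = (ast1 x y, 0)
                              /\ circ (x, 0) (y, 0) = (circ1 x y, 0)
            & forall a b : dual k A, ast (0, a) (0, b) = (0, ast2 a b)
                              /\ circ (0, a) (0, b) = (0, circ2 a b)]);
       matched_poisson
         (sub_star ast1) (sub_bracket circ1) (sub_star ast2) (sub_bracket circ2)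
         Q M P S;
       matched_pre_poisson ast1 circ1 ast2 circ2 l1 r1 rho1 mu1 l2 r2 rho2 mu2;
       pre_poisson_bialgebra ast1 circ1 D d].
Proof.
refine (@perfect_pairing_equivalences k A dA \1%VF _ _ ast1 circ1 ast2 circ2
  D d _ _ P S l2 r2 rho2 mu2 Q M l1 r1 rho1 mu1
  _ _ _ _ _ _ _ _ _ _ _ _ (omega_std A) _ pp1 pp2).
- by move=> v; exists v; rewrite evE.
- by move=> b; rewrite evE.
- by move=> a b x; rewrite !evE dual_prodE.
- by move=> a b x; rewrite !evE dual_prodE.
all: by move=> *; rewrite ?omega_stdE !evE.
Qed.
End DualMain.

Theorem theorem4p13 (k : fieldType) (A : vectType k)
    (ast1 circ1 : 'Hom(A, 'End(A))) (Delta delta : 'Hom(A, tensor A A)) :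
  let ast2 := dual_prod Delta in
  let circ2 := dual_prod delta in
  pre_poisson ast1 circ1 ->
  pre_poisson ast2 circ2 ->
  [<-> (exists ast circ : 'Hom(dual_sum k A, 'End(dual_sum k A)),
          [/\ quadratic_pre_poisson ast circ (omega_std A),
              forall x y : A, ast (x, 0) (y, 0) = (ast1 x y, 0)
                              /\ circ (x, 0) (y, 0) = (circ1 x y, 0)
            & forall a b : dual k A, ast (0, a) (0, b) = (0, ast2 a b)
                              /\ circ (0, a) (0, b) = (0, circ2 a b)]);
       matched_poisson
         (sub_star ast1) (sub_bracket circ1) (sub_star ast2) (sub_bracket circ2)
         (- dual_act ast1) (dual_act circ1)
         (- predual_act ast2) (predual_act circ2);
       matched_pre_poisson ast1 circ1 ast2 circ2
         (- dual_act ast1 - dual_act (flip ast1)) (dual_act (flip ast1))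
         (dual_act circ1 - dual_act (flip circ1)) (- dual_act (flip circ1))
         (- predual_act ast2 - predual_act (flip ast2)) (predual_act (flip ast2))
         (predual_act circ2 - predual_act (flip circ2)) (- predual_act (flip circ2));
       pre_poisson_bialgebra ast1 circ1 Delta delta].
Proof.
move=> ast2 circ2 pp1 pp2.
apply: (dual_equivalences _ _ _ _ _ _ _ _ _ _ _ _ pp1 pp2) => *.
- exact: dual_actN.
- exact: dual_actE.
- exact: predual_actN.
- exact: predual_actE.
- exact: dual_actNB_flip.
- exact: dual_act_flip.
- exact: dual_actB_flip.
- exact: dual_actN_flip.
- exact: predual_actNB_flip.
- exact: predual_act_flip.
- exact: predual_actB_flip.
- exact: predual_actN_flip.
Qed.
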